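(* Let $q\ge 2$ be a prime power, let $g\in\mathbb{F}_q[x]$ with $\delta=\deg g\ge 1$, and let $n\ge 1$. Let $R(n,g,q)$ be the number of monic polynomials $f\in\mathbb{F}_q[x]$ of degree $n$ that can be written as $f=h+g^k$, where $h$ is a monic irreducible polynomial of degree $n$ in $\mathbb{F}_q[x]$ and $k$ is a nonnegative integer, and put $r(n,g,q)=R(n,g,q)/q^n$. Then $$\frac{1+\delta/n}{\delta}\ \ge\ r(n,g,q)\ >\ \frac{(1-2q^{-n/2})^2\,(1+\delta/n)^{-1}}{\delta+8\,\frac{q}{q-1}\left(1+e^\gamma\min\left\{5\sqrt{\delta/q},\ \frac{\log 6\delta}{\log q}\right\}\right)},$$ where $\gamma$ is Euler's constant.
   Context: $\mathbb{F}_q$ denotes the finite field with $q$ elements. The bounds hold uniformly in $g$, $n\ge1$, $\delta\ge1$, $q\ge2$. *)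

(* Defs.v *)
From HB Require Import structures.
From mathcomp Require Import all_boot all_order all_algebra all_field.
From mathcomp Require Import boolp classical_sets filter reals topology normedtype exp sequences.
Set Implicit Arguments. Unset Strict Implicit. Unset Printing Implicit Defensive.
Import Order.TTheory GRing.Theory Num.Theory numFieldNormedType.Exports.
Local Open Scope ring_scope.

(* The monic polynomial of degree n with lower coefficients c:
   x^n + c_{n-1} x^{n-1} + ... + c_0.  This is a bijection between
   {ffun 'I_n -> F} and the monic polynomials of degree n. *)
Definition monic_of (F : fieldType) (n : nat) (c : {ffun 'I_n -> F}) : {poly F} :=
  'X^n + \sum_(i < n) c i *: 'X^i.

Definition Rcount (F : finFieldType) (n : nat) (g : {poly F}) : nat :=
  #|[set c : {ffun 'I_n -> F} |
      `[< exists (h : {poly F}) (k : nat),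
            [/\ h \is monic, size h = n.+1, irreducible_poly h &
                monic_of c = h + g ^+ k] >]]|.

Definition rdens (R : realType) (F : finFieldType) (n : nat) (g : {poly F}) : R :=
  (Rcount n g)%:R / (#|F|%:R ^+ n).

Definition euler_gamma (R : realType) : R :=
  limn (fun N : nat => \sum_(0 <= k < N) (k.+1%:R)^-1 - ln (N%:R : R)).

(* Main.v *)
Require Import Defs.
From HB Require Import structures.
From mathcomp Require Import all_boot all_order all_algebra all_field.
From mathcomp Require Import boolp classical_sets filter reals topology normedtype exp sequences.
From mathcomp Require Import functions derive realfun.
From mathcomp Require Import ring lra zify.
Set Implicit Arguments. Unset Strict Implicit. Unset Printing Implicit Defensive.
Import Order.TTheory GRing.Theory Num.Theory numFieldNormedType.Exports.
Local Open Scope ring_scope.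

(** Let N(a) count the monic irreducible h of degree n with h + a irreducible. By
    Cauchy-Schwarz applied to the number of representations f = h + g^k, a lower bound
    for R(n,g,q) follows from an upper bound for the sum of N(g^k - g^l) over the pairs
    k, l with k deg g, l deg g < n.

    Since polynomials of degree < n are exactly equidistributed modulo any modulus of
    degree <= n, the large sieve of level n/2 has no error term. It gives
    N(a) <= 8 (q^n / n^2) T(a), where T(a) is the product of (1 - 1/|p|)^-1 over the
    primes p | a of degree at most n/2.

    For T(g (g^j - 1)), expand the product over sets S of primes. The exponents j with
    S dividing g (g^j - 1) are multiples of the least one, e(S), so at most x / e(S) of
    them are at most x; grouping the sets S by e(S) bounds the average over j <= x by a
    weighted mean of T(g (g - 1) ... (g^e - 1)) over e <= x. Finally, T(a) is at most
    q / (q - 1) times the exponential of the sum of 1/|p| over p | a, and that sum is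
    largest when the degree of a is spent on the primes of smallest degree; there it is
    a harmonic number, and this is where Euler's constant enters. *)

(** * Prime polynomials over a finite field *)

(** The bounds are uniform in q, n and deg g, so every estimate must be an inequality without error
    term. For the sieve sum this is done with truncated power series: in the variable X/q the zeta
    function of F[x] is 1/(1 - X), and the sieve sum times T(a) is at least a coefficient of 1/(1 -
    X)^3. At level n/2 that coefficient is at least n^2/8, whence the 8.

    Bounding each T(g (g^j - 1)) on its own would cost a factor of order log j. After averaging, e
    has weight 1/(e (e + 1)) against a growth of order log e, so the mean is bounded independently
    of n.

    The minimum comes from two bounds for the same T: the exponential of deg/q, good while the
    degree is at most of order q, and a logarithm of the degree. The mean of the logarithm costs the
    factor 6; switching between the bounds near e = sqrt(q / deg g) costs the factor 5.

    The number K of exponents k with k deg g < n lies between n / deg g and n / deg g + 1. The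
    larger value gives the upper bound of the theorem; the smaller one makes the pairs k = l
    contribute the term deg g of the denominator. *)

Section Primes.
Variable F : finFieldType.
Implicit Types (p f g r : {poly F}).

Definition deg f : nat := (size f).-1.

Definition mirr p := (p \is monic) && irreducibleb p.

Lemma mirrP p : reflect (p \is monic /\ irreducible_poly p) (mirr p).
Proof. by apply: (iffP andP) => -[? /irreducibleP]. Qed.

Lemma mirr_neq0 p : mirr p -> p != 0.
Proof. by case/andP => /monic_neq0. Qed.

Lemma size_deg f : f != 0 -> size f = (deg f).+1.
Proof. by rewrite /deg -size_poly_gt0; case: (size f). Qed.

Lemma degM f g : f != 0 -> g != 0 -> deg (f * g) = (deg f + deg g)%N.
Proof. by move=> f0 g0; rewrite {1}/deg size_mul // !size_deg // addnS. Qed.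

Lemma degX f k : f != 0 -> deg (f ^+ k) = (k * deg f)%N.
Proof.
move=> f0; elim: k => [|k IHk]; first by rewrite expr0 /deg size_poly1.
by rewrite exprS degM ?expf_neq0 // IHk mulSn.
Qed.

Lemma dvdp_deg f g : g != 0 -> f %| g -> (deg f <= deg g)%N.
Proof.
move=> g0 fg; have f0 := dvdpN0 fg g0.
by rewrite -ltnS -!size_deg // dvdp_leq.
Qed.

Lemma mirr_deg_gt0 p : mirr p -> (0 < deg p)%N.
Proof. by case/mirrP => _ [sp _]; rewrite /deg; case: (size p) sp => [|[]]. Qed.

Lemma mirr_dvd_eq p r : mirr p -> mirr r -> p %| r -> p = r.
Proof.
case/mirrP => mp [sp _] /mirrP [mr [_ hr]] /hr; rewrite gtn_eqF // => /(_ isT).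
by rewrite eqp_monic // => /eqP.
Qed.

Lemma mirr_coprime p f : mirr p -> coprimep p f = ~~ (p %| f).
Proof.
case/mirrP => mp [sp hp]; apply/idP/idP => [cpf|npf].
  by apply/negP => /dvdp_gcd_idl/eqp_size; rewrite (eqP cpf) => s1; rewrite -s1 in sp.
rewrite coprimep_def; case: eqP => // /eqP /hp /(_ (dvdp_gcdl _ _)) e.
by case/negP: npf; rewrite -(eqp_dvdl _ e) dvdp_gcdr.
Qed.

Lemma mirr_coprimeE p r : mirr p -> mirr r -> coprimep p r = (p != r).
Proof.
move=> hp hr; rewrite mirr_coprime //; apply/idP/idP.
  by apply: contraNneq => ->.
by apply: contra_neqN; apply: mirr_dvd_eq.
Qed.

Lemma mirr_dvdM p f g : mirr p -> (p %| f * g) = (p %| f) || (p %| g).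
Proof.
move=> hp; apply/idP/orP => [|[] h]; last 2 first.
- by rewrite dvdp_mulr.
- by rewrite dvdp_mull.
case: (boolP (p %| f)) => [|npf]; first by left.
by rewrite Gauss_dvdpr ?mirr_coprime //; right.
Qed.

Lemma mirr_dvdX p f k : mirr p -> (0 < k)%N -> (p %| f ^+ k) = (p %| f).
Proof.
move=> hp; elim: k => // -[_ _|k IHk _]; first by rewrite expr1.
by rewrite exprS mirr_dvdM // IHk // orbb.
Qed.

Lemma mirr_dvd_prod (I : Type) (s : seq I) (P : pred I) (G : I -> {poly F}) p :
  mirr p -> (p %| \prod_(i <- s | P i) G i) = has (fun i => P i && (p %| G i)) s.
Proof.
move=> hp; elim: s => [|i s IHs] /=.
  rewrite big_nil dvdp1; case/mirrP: hp => _ [sp _]; exact: gtn_eqF.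
by rewrite big_cons; case: (P i) => //=; rewrite mirr_dvdM // IHs.
Qed.

Lemma exists_mirr_dvd f : (1 < size f)%N -> exists2 p, mirr p & p %| f.
Proof.
elim: {f}(size f) {-2}f (leqnn (size f)) => [|n IHn] f sf f1.
  by have := leq_trans f1 sf.
case: (boolP (irreducibleb f)) => [irf|].
  have f0 : f != 0 by rewrite -size_poly_gt0 (leq_trans _ f1).
  have l0 : (lead_coef f)^-1 != 0 by rewrite invr_eq0 lead_coef_eq0.
  exists ((lead_coef f)^-1 *: f); last by rewrite dvdpZl.
  apply/mirrP; split; first by rewrite monicE lead_coefZ mulVf ?lead_coef_eq0.
  case/irreducibleP: irf => _ hf; split; rewrite ?size_scale // => g g1 gf.
  rewrite (eqp_trans (hf g g1 _)) ?(eqp_sym f) ?eqp_scale //.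
  by rewrite -(dvdpZr _ _ l0).
rewrite /irreducibleb f1 /= negb_forall => /existsP[g].
rewrite negb_imply -Pdiv.Idomain.dvdpE -ltnNge => /andP[gf g1].
have sg := size_npoly g.
have {}sg : (size g <= n)%N.
  by rewrite (leq_trans sg) // -ltnS prednK // (leq_trans _ f1).
by have [p hp pg] := IHn _ sg g1; exists p => //; apply: dvdp_trans gf.
Qed.

End Primes.

(** * Multiples of a polynomial and prime powers of given degree *)

Section Counting.
Variable F : finFieldType.
Local Notation q := #|F|.
Implicit Types (p f g r : {poly F}).

Lemma q_gt1 : (1 < q)%N.
Proof. exact: finNzRing_gt1. Qed.

(** The index type [{poly_n F}] is a finite additive group, so a shift by a polynomial of degree
    less than n is a bijection of the monic polynomials of degree n. [RcountE] translates from the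
    coefficient vectors of [monic_of]. *)
Definition mon n (c : {poly_n F}) : {poly F} := 'X^n + (c : {poly F}).

Lemma size_mon n (c : {poly_n F}) : size (mon c) = n.+1.
Proof. by rewrite /mon size_polyDl ?size_polyXn // ltnS size_npoly. Qed.

Lemma deg_mon n (c : {poly_n F}) : deg (mon c) = n.
Proof. by rewrite /deg size_mon. Qed.

Lemma monic_mon n (c : {poly_n F}) : mon c \is monic.
Proof.
rewrite monicE lead_coefDl ?lead_coefXn //.
by rewrite size_polyXn ltnS size_npoly.
Qed.

Lemma mon_neq0 n (c : {poly_n F}) : mon c != 0.
Proof. exact/monic_neq0/monic_mon. Qed.

Lemma mon_inj n : injective (@mon n).
Proof. by move=> c d /addrI /val_inj. Qed.

Lemma monP n f : f \is monic -> deg f = n -> exists c : {poly_n F}, f = mon c.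
Proof.
move=> mf df.
have sf : (size (f - 'X^n)%R <= n)%N.
  have sf : size f = n.+1 by rewrite size_deg ?df ?monic_neq0.
  apply/leq_sizeP => j; rewrite leq_eqVlt coefB coefXn => /orP[/eqP<-|nj].
    by rewrite eqxx; move/monicP: mf; rewrite /lead_coef sf => ->; rewrite subrr.
  by rewrite nth_default ?sf // gtn_eqF // subr0.
by exists (NPoly sf); rewrite /mon /= addrC subrK.
Qed.

Lemma card_mon_dvd n f : f \is monic -> (deg f <= n)%N ->
  #|[set c : {poly_n F} | f %| mon c]| = (q ^ (n - deg f))%N.
Proof.
move=> mf fn; rewrite -card_npoly.
have h (d : {poly_(n - deg f) F}) : {c : {poly_n F} | f * mon d = mon c}.
  apply: sig_eqW; apply: monP; first by rewrite rpredM // monic_mon.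
  by rewrite degM ?monic_neq0 ?monic_mon // deg_mon subnKC.
rewrite -cardsT -[RHS](card_imset (f := fun d => sval (h d))).
  congr #|pred_of_set _|; apply/setP => c; rewrite !inE.
  apply/idP/imsetP => [/dvdpP[g e]|[d _ ->]]; last first.
    by case: (h d) => /= _ <-; rewrite dvdp_mulr.
  have g0 : g != 0.
    by apply: contra_eq_neq e => ->; rewrite mul0r mon_neq0.
  have [||d gd] := @monP (n - deg f) g.
  - by rewrite -(monicMl _ mf) mulrC -e monic_mon.
  - by have := deg_mon c; rewrite e degM ?(monic_neq0 mf) // => <-; rewrite addnK.
  exists d => //; case: (h d) => /= c'; rewrite -gd mulrC -e.
  by move/mon_inj.
move=> d d' /=; case: (h d) (h d') => /= c e [/= c' e'] cc'.
by move: e; rewrite cc' -e' => /(mulfI (monic_neq0 mf)) /mon_inj.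
Qed.

Lemma mirr_npoly M p : mirr p -> (deg p <= M)%N ->
  exists2 p' : {poly_M.+1 F}, mirr p' & p = p'.
Proof.
move=> hp dp.
have sp : (size p <= M.+1)%N by rewrite size_deg ?mirr_neq0.
by exists (NPoly sp).
Qed.

(* The only form of unique factorization that is needed. *)
Lemma sum_deg_prime_powers M f : f \is monic -> (deg f <= M)%N ->
  (\sum_(p : {poly_M.+1 F} | mirr p) \sum_(1 <= k < M.+1) deg p * ((p : {poly F}) ^+ k %| f)%R = deg f)%N.
Proof.
elim: {f}(size f) {-2}f (leqnn (size f)) => [|n IHn] f sf mf fM.
  by move: sf mf; rewrite leqn0 size_poly_eq0 => /eqP->; rewrite monicE lead_coef0 eq_sym oner_eq0.
case: (ltnP 1 (size f)) => [f1|]; last first.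
  move=> s1; have /eqP-> : f == 1.
    have : size f = 1 by apply/eqP; rewrite eqn_leq s1 size_poly_gt0 monic_neq0.
    by case/eqP/size_poly1P => a _ fa; move: mf; rewrite fa monicE lead_coefC => /eqP->.
  rewrite {2}/deg size_poly1 big1 // => p hp.
  rewrite big_nat_cond big1 // => k; rewrite andbT => /andP[k1 _].
  case: (boolP (_ %| 1)); rewrite ?muln0 // => /(dvdp_trans (dvdp_exp2l _ k1)).
  by rewrite expr1 => /(dvdp_deg (oner_neq0 _)); rewrite leqNgt {1}/deg size_poly1 mirr_deg_gt0.
have [p0 hp0 p0f] := exists_mirr_dvd f1.
have [p0' p0'M e] := mirr_npoly hp0 (leq_trans (dvdp_deg (monic_neq0 mf) p0f) fM).
rewrite {}e in hp0 p0f *.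
case/dvdpP: (p0f) => g fg.
have mp0 : val p0' \is monic by case/andP: hp0.
have mg : g \is monic by rewrite -(monicMl _ mp0) mulrC -fg.
have df : deg f = (deg g + deg p0')%N by rewrite fg degM ?monic_neq0.
have dp0 := mirr_deg_gt0 hp0.
have := IHn g; rewrite df; move=> <- //; last 2 first.
- by move: sf; rewrite (size_deg (monic_neq0 mf)) (size_deg (monic_neq0 mg)); lia.
- by lia.
rewrite (bigD1 p0') //= [in RHS](bigD1 p0') //= addnAC; congr (_ + _)%N; last first.
  apply: eq_bigr => p /andP[hp pp0].
  apply: eq_bigr => k _; congr (_ * nat_of_bool _)%N.
  by rewrite fg Gauss_dvdpl // coprimep_expl // mirr_coprimeE.
(* For the prime divided out, exponent k at f corresponds to exponent k - 1 at g: k = 1 supplies the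
   missing degree, and exponent M at g gives nothing because deg g < M. *)
have gM : (deg g < M)%N by lia.
have step (k : nat) : ((val p0' ^+ k.+1 %| f) = (val p0' ^+ k %| g))%R.
  by rewrite fg exprSr dvdp_mul2r ?mirr_neq0.
have top : ((val p0' ^+ M %| g) = false)%R.
  apply/negP => /(dvdp_deg (monic_neq0 mg)); rewrite degX ?mirr_neq0 //.
  by rewrite leqNgt (leq_trans gM) // leq_pmulr.
rewrite -!big_distrr /= big_add1 /=.
under eq_bigr do rewrite step.
have M0 : (0 < M)%N by apply: leq_trans gM.
rewrite big_ltn // expr0 dvd1p mulnDr muln1 addnC; congr (_ * _ + _)%N.
by rewrite [RHS]big_nat_recr //= top addn0.
Qed.

End Counting.

Section Counting2.
Variable F : finFieldType.
Local Notation q := #|F|.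
Implicit Types (p f g r : {poly F}).

(** The analogue of writing a sum of logarithms with the von Mangoldt function: the identity
    [sum_deg_prime_powers] is added up over all monic polynomials of degree n, and multiples of p^k
    are counted exactly. *)
Lemma sum_prime_powers_mul M n : (n <= M)%N ->
  (\sum_(p : {poly_M.+1 F} | mirr p) \sum_(1 <= k < M.+1)
     deg p * ((k * deg p <= n) * q ^ (n - k * deg p)) = n * q ^ n)%N.
Proof.
move=> nM; rewrite -(@card_npoly F n) -[#|{: {poly_n F}}|]sum1_card big_distrr /=.
rewrite [RHS](eq_bigr (fun c : {poly_n F} => \sum_(p : {poly_M.+1 F} | mirr p)
  \sum_(1 <= k < M.+1) deg p * ((p : {poly F}) ^+ k %| mon c)%R)%N); last first.
  by move=> c _; rewrite muln1 sum_deg_prime_powers ?monic_mon ?deg_mon.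
rewrite [RHS]exchange_big /=; apply: eq_bigr => p hp.
rewrite [RHS]exchange_big /=; apply: eq_bigr => k _.
rewrite -big_distrr /=; congr (_ * _)%N.
have p0 := mirr_neq0 hp.
have mp : val p \is monic by case/andP: hp.
have dk := degX k p0; case: leqP => kn; rewrite ?mul1n ?mul0n.
  rewrite -dk -card_mon_dvd ?rpredX ?dk //.
  by rewrite -sum1dep_card big_mkcond /=; apply: eq_bigr => c _; case: (_ %| _).
rewrite big1 // => c _; case: (boolP (_ %| _)) => // /(dvdp_deg (mon_neq0 _)).
by rewrite deg_mon dk leqNgt kn.
Qed.

(** Gauss's formula. It is [sum_prime_powers_mul] at n minus q times the same identity at n - 1: the
    prime powers of degree below n cancel. *)
Lemma sum_deg_prime_power_degree M n : (0 < n <= M)%N ->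
  (\sum_(p : {poly_M.+1 F} | mirr p) \sum_(1 <= k < M.+1)
     deg p * (k * deg p == n) = q ^ n)%N.
Proof.
case: n => // n /= nM.
have := sum_prime_powers_mul nM; have := sum_prime_powers_mul (ltnW nM).
set A := (X in X = _ -> _) => hA; set B := (X in X = _ -> _) => hB.
set S := (X in X = _); suff : (B = q * A + S)%N.
  by rewrite hA hB expnS; lia.
rewrite /B /A /S big_distrr -big_split /=; apply: eq_bigr => p hp.
rewrite big_distrr -big_split /=; apply: eq_bigr => k _.
rewrite [(q * (deg _ * _))%N]mulnCA -mulnDr; congr (_ * _)%N.
case: (ltngtP (k * deg p) n.+1) => kn; rewrite ?mul1n ?mul0n ?muln0 //.
- by rewrite -ltnS kn mul1n subSn ?expnS ?addn0 // -ltnS.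
- by rewrite leqNgt (ltnW kn) mul0n muln0.
- by rewrite kn subnn ltnn mul0n muln0.
Qed.

Definition npi n : nat := #|[set c : {poly_n F} | mirr (mon c)]|.

Lemma sum_mirr_deg M n (G : nat -> nat) : (n <= M)%N ->
  (\sum_(p : {poly_M.+1 F} | mirr p && (deg p == n)) G (deg p) = npi n * G n)%N.
Proof.
move=> nM; rewrite (eq_bigr (fun=> G n)); last by move=> p /andP[_ /eqP->].
rewrite sum_nat_const; congr (_ * _)%N.
have sm (c : {poly_n F}) : (size (mon c) <= M.+1)%N by rewrite size_mon.
rewrite /npi -(card_imset (f := fun c => NPoly (sm c))); last first.
  by move=> c d [] /mon_inj.
apply: eq_card => p; rewrite unfold_in; apply/andP/imsetP => [[hp /eqP dp]|[c]].
  have mp : val p \is monic by case/andP: hp.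
  have [c pc] := monP mp dp; exists c; first by rewrite inE -pc.
  exact: val_inj.
by rewrite inE => hc ->; rewrite /= deg_mon.
Qed.

Lemma npi_le n : (0 < n)%N -> (n * npi n <= q ^ n)%N.
Proof.
move=> n0; rewrite -(@sum_deg_prime_power_degree n n) ?n0 ?leqnn //.
rewrite mulnC -(sum_mirr_deg id (leqnn n)) big_mkcondr /=.
apply: leq_sum => p _; rewrite big_ltn // mul1n.
by case: eqP; rewrite // muln1 leq_addr.
Qed.

(** A proper prime power of degree n comes from a prime of degree at most n/2, with at most one
    exponent per prime. In Gauss's formula these contribute at most the sum of d * npi d over d <=
    n/2, to which [npi_le] applies. *)
Lemma npi_ge n : (0 < n)%N ->
  (q ^ n <= n * npi n + \sum_(1 <= d < (n./2).+1) q ^ d)%N.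
Proof.
move=> n0; rewrite -(@sum_deg_prime_power_degree n n) ?n0 ?leqnn //.
apply: (@leq_trans (n * npi n + \sum_(1 <= d < (n./2).+1) npi d * d)); last first.
  rewrite leq_add2l big_nat_cond [leqRHS]big_nat_cond.
  by apply: leq_sum => d /andP[/andP[d0 _] _]; rewrite mulnC npi_le.
rewrite mulnC -(sum_mirr_deg id (leqnn n)).
under eq_big_nat => d /andP[_ dn].
  rewrite -(@sum_mirr_deg n d id); last by lia.
  over.
rewrite [X in (_ <= X + _)%N]big_mkcondr /=.
have -> : (\sum_(1 <= d < (n./2).+1) \sum_(p : {poly_n.+1 F} | mirr p && (deg p == d)) deg p =
  \sum_(p : {poly_n.+1 F} | mirr p) (if deg p <= n./2 then deg p else 0))%N.
  under eq_bigr do rewrite big_mkcondr.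
  rewrite exchange_big /=; apply: eq_bigr => p hp.
  have dp := mirr_deg_gt0 hp.
  rewrite -big_mkcond /= (big_nat_widen _ _ (maxn (n./2) (deg p)).+1) ?ltnS ?leq_maxl //.
  rewrite (eq_bigl (fun d => (d == deg p) && (deg p <= n./2)%N)); last first.
    by move=> d /=; rewrite ltnS eq_sym; case: eqP => //= ->.
  case: (leqP (deg p) n./2) => h; last by rewrite big1 // => d; rewrite andbF.
  under eq_bigl do rewrite andbT.
  by rewrite big_nat1_eq dp ltnS h.
rewrite -big_split /=; apply: leq_sum => p hp.
have dp := mirr_deg_gt0 hp.
rewrite big_ltn // mul1n leq_add //; first by case: eqP; rewrite ?muln1 ?muln0.
rewrite -big_distrr /=.
case: (leqP (deg p) n./2) => h; last first.
  rewrite big_nat_cond big1 ?muln0 // => k /andP[/andP[k2 _] _].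
  case: eqP => // e; exfalso.
  have : (2 * deg p <= k * deg p)%N by rewrite leq_mul2r k2 orbT.
  rewrite e.
  by lia.
rewrite -[leqRHS]muln1 leq_mul2l; apply/orP; right.
case: (boolP (deg p %| n)%N) => [/dvdnP[k0 e]|ndv]; last first.
  rewrite big1 // => k _; case: eqP => // e; case/negP: ndv.
  by apply/dvdnP; exists k.
rewrite (eq_bigr (fun k => if k == k0 then 1 else 0)%N); last first.
  move=> k _; rewrite (_ : (_ == n) = (k == k0)); first by case: eqP.
  apply/eqP/eqP => [h1|->]; last exact: esym.
  by apply/eqP; rewrite -(eqn_pmul2r dp) h1; apply/eqP.
by rewrite -big_mkcond big_nat1_eq; case: ifP.
Qed.
End Counting2.

(** * Truncated power series and the sieve sum *)

Section TruncatedSeries.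
Variables (R : realFieldType) (M : nat).
Implicit Types (A B W : {poly R}).

Definition eqt A B := forall i, (i <= M)%N -> A`_i = B`_i.

Lemma eqtM A A' B B' : eqt A A' -> eqt B B' -> eqt (A * B) (A' * B').
Proof.
move=> hA hB i iM; rewrite !coefM; apply: eq_bigr => j _.
by rewrite hA ?hB // ?(leq_trans _ iM) ?leq_subr // -ltnS.
Qed.

Lemma eqt_prod (I : Type) (s : seq I) (P : pred I) (G H : I -> {poly R}) :
  (forall i, P i -> eqt (G i) (H i)) ->
  eqt (\prod_(i <- s | P i) G i) (\prod_(i <- s | P i) H i).
Proof. by move=> h; elim/big_rec2: _ => // i A B Pi; apply/eqtM/h. Qed.

(* The relation 'X * A^`() = A * L modulo 'X^(M+1), i.e. L is the logarithmic
   derivative of A. *)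
Definition log_deriv A L := forall i, (i <= M)%N -> i%:R * A`_i = (A * L)`_i.

Lemma log_derivM A B L L' :
  log_deriv A L -> log_deriv B L' -> log_deriv (A * B) (L + L').
Proof.
move=> hA hB i iM; rewrite mulrDr mulrAC -[A * B * L']mulrA coefD coefM mulr_sumr.
rewrite [(A * L * B)`_i]coefM [(A * (B * L'))`_i]coefM -big_split /=; apply: eq_bigr => j _.
have ji : (j <= i)%N by rewrite -ltnS.
rewrite -hA ?(leq_trans ji) // -hB ?(leq_trans _ iM) ?leq_subr //.
by rewrite natrB //; ring.
Qed.

Lemma log_deriv_prod (I : Type) (s : seq I) (P : pred I) (G L : I -> {poly R}) :
  (forall i, P i -> log_deriv (G i) (L i)) ->
  log_deriv (\prod_(i <- s | P i) G i) (\sum_(i <- s | P i) L i).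
Proof.
move=> h; elim/big_rec2: _ => [i _|i A B Pi hA]; last exact/log_derivM/hA/h.
by rewrite mulr0 coef0 coef1; case: i => [|i]; rewrite ?mul0r ?mulr0.
Qed.

(** Inverse of 1 - c X^d modulo X^(M+1); M + 1 terms suffice for every d > 0. *)
Definition geom (c : R) (d : nat) : {poly R} := \sum_(k < M.+1) c ^+ k *: 'X^(k * d).

Lemma geom_telescope c d : (1 - c *: 'X^d) * geom c d = 1 - c ^+ M.+1 *: 'X^(M.+1 * d).
Proof.
rewrite /geom -[RHS]opprB; elim: M => [|n IHn].
  by rewrite big_ord1 expr0 mul0n expr0 scale1r mulr1 mul1n expr1 opprB.
rewrite big_ord_recr mulrDr IHn mulrBl mul1r -scalerAl -scalerAr scalerA -exprD -exprS mulSn.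
ring.
Qed.

Lemma geom_inv c d : (0 < d)%N -> eqt ((1 - c *: 'X^d) * geom c d) 1.
Proof.
move=> d0 i iM; rewrite geom_telescope coefB coefZ coefXn ltn_eqF ?mulr0 ?subr0 //.
by apply: (@leq_trans M.+1); rewrite ?leq_pmulr.
Qed.

Lemma log_deriv_1subX c d : (0 < d)%N ->
  log_deriv (1 - c *: 'X^d) (- \sum_(1 <= k < M.+1) (d%:R * c ^+ k) *: 'X^(k * d)).
Proof.
move=> d0 i iM.
have -> : \sum_(1 <= k < M.+1) (d%:R * c ^+ k) *: 'X^(k * d) = d%:R *: (geom c d - 1).
  rewrite /geom -(big_mkord xpredT (fun k => c ^+ k *: 'X^(k * d))) big_ltn //.
  rewrite expr0 mul0n expr0 scale1r addrAC subrr add0r scaler_sumr.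
  by apply: eq_bigr => k _; rewrite scalerA.
rewrite mulrN -scalerAr mulrBr mulr1 coefN coefZ [in RHS]coefB geom_inv // !coefB coefZ coefXn coef1.
case: (eqVneq i d) => [->|_]; first by rewrite gtn_eqF //=; ring.
by case: i iM => [|i] _; rewrite ?eqxx /=; ring.
Qed.

Definition ones : {poly R} := \poly_(i < M.+1) 1.

Lemma coef_ones_mul A t : (t <= M)%N -> (ones * A)`_t = \sum_(i < t.+1) A`_i.
Proof.
move=> tM; rewrite mulrC coefM; apply: eq_bigr => i _.
by rewrite coef_poly ltnS (leq_trans _ tM) ?leq_subr // mulr1.
Qed.

Definition pnonneg A := forall i, 0 <= A`_i.

Lemma pnonneg_add A B : pnonneg A -> pnonneg B -> pnonneg (A + B).
Proof. by move=> hA hB i; rewrite coefD addr_ge0. Qed.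

Lemma pnonneg_mul A B : pnonneg A -> pnonneg B -> pnonneg (A * B).
Proof. by move=> hA hB i; rewrite coefM sumr_ge0 // => j _; rewrite mulr_ge0. Qed.

Lemma pnonneg_sum (I : Type) (s : seq I) (P : pred I) (G : I -> {poly R}) :
  (forall i, P i -> pnonneg (G i)) -> pnonneg (\sum_(i <- s | P i) G i).
Proof.
move=> h; elim/big_ind: _ => //; last exact: pnonneg_add.
by move=> i; rewrite coef0.
Qed.

Lemma pnonneg_prod (I : Type) (s : seq I) (P : pred I) (G : I -> {poly R}) :
  (forall i, P i -> pnonneg (G i)) -> pnonneg (\prod_(i <- s | P i) G i).
Proof.
move=> h; elim/big_ind: _ => //; last exact: pnonneg_mul.
by move=> i; rewrite coef1; case: eqP.
Qed.

Lemma pnonneg_scaleXn c k : 0 <= c -> pnonneg (c *: 'X^k).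
Proof. by move=> c0 i; rewrite coefZ coefXn mulr_ge0 //; case: eqP. Qed.

Lemma pnonneg_geom c d : 0 <= c -> pnonneg (geom c d).
Proof. by move=> c0; apply: pnonneg_sum => k _; apply: pnonneg_scaleXn; rewrite exprn_ge0. Qed.

Lemma horner1_sum A t : pnonneg A -> \sum_(i < t.+1) A`_i <= A.[1].
Proof.
move=> hA; rewrite horner_coef; under [leRHS]eq_bigr do rewrite expr1n mulr1.
rewrite -(big_mkord xpredT (fun i => A`_i)) -[leRHS](big_mkord xpredT (fun i => A`_i)).
case: (leqP t.+1 (size A)) => h.
  by rewrite [leRHS](big_cat_nat _ h) //= lerDl sumr_ge0 // => i _.
rewrite (big_cat_nat _ (ltnW h)) //= gerDl big_nat_cond big1 // => i /andP[/andP[hi _] _].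
by rewrite nth_default.
Qed.

Lemma geom_split c d : 0 <= c ->
  exists2 H, pnonneg H & geom c d ^+ 2 = 1 + 'X^d * H.
Proof.
move=> c0; have [g hg ->] : exists2 g, pnonneg g & geom c d = 1 + 'X^d * g.
  exists (\sum_(k < M) c ^+ k.+1 *: 'X^(k * d)).
    by apply: pnonneg_sum => k _; apply: pnonneg_scaleXn; rewrite exprn_ge0.
  rewrite /geom big_ord_recl expr0 mul0n expr0 scale1r mulr_sumr; congr (_ + _).
  by apply: eq_bigr => k _; rewrite -scalerAr -exprD.
exists (g + g + 'X^d * (g * g)); last by ring.
apply: pnonneg_add; first exact: pnonneg_add.
apply: pnonneg_mul; last exact: pnonneg_mul.
by move=> i; rewrite coefXn; case: eqP.
Qed.

Lemma horner1_geom_le c d : 0 <= c < 1 -> (geom c d).[1] <= (1 - c)^-1.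
Proof.
move=> /andP[c0 c1]; rewrite -[leRHS]mul1r ler_pdivlMr ?subr_gt0 //.
have := congr1 (fun A => A.[1]) (geom_telescope c d).
rewrite hornerM !hornerE !expr1n !mulr1 mulrC => ->.
by rewrite lerBlDr lerDl exprn_ge0.
Qed.

(* Moving mass of a power series towards lower degrees increases the partial
   sums, here for a two-term polynomial against the square of a geometric series. *)
Lemma two_term_dominates al be c d A t : (t <= M)%N ->
  0 <= c < 1 -> 1 <= al -> (1 - c) ^- 2 <= al + be -> pnonneg A ->
  (geom c d ^+ 2 * (ones * A))`_t <= ((al%:P + be *: 'X^d) * (ones * A))`_t.
Proof.
move=> tM c01 al1 albe hA.
have [c0 c1] := andP c01.
have [H hH e] := geom_split d c0.
have H1 : 1 + H.[1] <= al + be.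
  have := congr1 (fun B => B.[1]) e.
  rewrite !hornerE expr1n mul1r => <-; apply: le_trans albe.
  rewrite -exprVn lerXn2r ?nnegrE ?horner1_geom_le //; last by rewrite invr_ge0 subr_ge0 ltW.
  rewrite horner_coef sumr_ge0 // => i _; rewrite mulr_ge0 ?expr1n //.
  exact: pnonneg_geom.
have H0 : 0 <= H.[1] by rewrite horner_coef sumr_ge0 // => i _; rewrite mulr_ge0 ?expr1n.
have hW : pnonneg (ones * A).
  by apply: pnonneg_mul => // i; rewrite coef_poly; case: ifP.
(* This is what the factor [ones] is for: up to degree M the coefficients are partial sums of a
   nonnegative series. *)
have mono i j : (i <= j)%N -> (j <= M)%N -> (ones * A)`_i <= (ones * A)`_j.
  move=> ij jM; rewrite !coef_ones_mul ?(leq_trans ij) //.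
  rewrite -(big_mkord xpredT (fun i => A`_i)) -[leRHS](big_mkord xpredT (fun i => A`_i)).
  by rewrite [leRHS](@big_cat_nat _ _ _ i.+1) //= lerDl sumr_ge0.
rewrite e mulrDl mul1r -mulrA mulrDl -scalerAl !coefD coefZ mul_polyC coefZ !coefXnM.
case: ltnP => td; first by rewrite mulr0 !addr0 ler_peMl.
have hle : (H * (ones * A))`_(t - d) <= H.[1] * (ones * A)`_(t - d).
  rewrite coefM; apply: (@le_trans _ _ (\sum_(j < (t - d).+1) H`_j * (ones * A)`_(t - d))).
    by apply: ler_sum => j _; rewrite ler_wpM2l // mono ?leq_subr // (leq_trans (leq_subr _ _)).
  by rewrite -mulr_suml ler_wpM2r // horner1_sum.
(* The total mass [H.[1]] is at most al + be - 1: the part be is absorbed at degree t - d, and the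
   part al - 1 at degree t, where the coefficient is no smaller. *)
have := mono _ _ (leq_subr d t) tM; have := hW (t - d)%N; nra.
Qed.

(** The factors are exchanged one at a time. The factor [ones] stays throughout, since each exchange
    relies on monotone coefficients. *)
Lemma prod_two_term_dominates (I : Type) (s : seq I) (P : pred I)
    (al be c : I -> R) (d : I -> nat) t : (t <= M)%N ->
  (forall i, P i -> 0 <= c i < 1) -> (forall i, P i -> 1 <= al i) ->
  (forall i, P i -> 0 <= be i) ->
  (forall i, P i -> (1 - c i) ^- 2 <= al i + be i) ->
  (ones * (\prod_(i <- s | P i) geom (c i) (d i)) ^+ 2)`_t <=
  (ones * \prod_(i <- s | P i) ((al i)%:P + be i *: 'X^(d i)))`_t.
Proof.
move=> tM hc hal hbe halbe; elim: s t tM => [|i s IHs] t tM.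
  by rewrite !big_nil expr1n.
rewrite !big_cons; case: ifP => Pi; last exact: IHs.
rewrite exprMn mulrCA (mulrCA _ (_ + _)).
apply: le_trans (two_term_dominates _ tM (hc _ Pi) (hal _ Pi) (halbe _ Pi) _) _.
  rewrite expr2; apply: pnonneg_mul; apply: pnonneg_prod => j Pj.
    by apply: pnonneg_geom; case/andP: (hc _ Pj).
  by apply: pnonneg_geom; case/andP: (hc _ Pj).
rewrite !mulrDl -!scalerAl !mul_polyC !coefD !coefZ !coefXnM lerD //.
  by rewrite ler_wpM2l ?IHs // (le_trans ler01) // hal.
rewrite ler_wpM2l ?hbe //; case: ltnP => // dt.
by apply: IHs; apply: leq_trans tM; apply: leq_subr.
Qed.

Lemma coef_ones_cubed t : (t <= M)%N -> (ones * ones ^+ 2)`_t = (t.+1 * t.+2)%:R / 2.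
Proof.
move=> tM; rewrite coef_ones_mul //.
rewrite (eq_bigr (fun i : 'I_t.+1 => (i.+1)%:R)); last first.
  move=> i _; have iM : (i <= M)%N by apply: leq_trans tM; rewrite -ltnS.
  rewrite expr2 coef_ones_mul // (eq_bigr (fun=> 1)) ?sumr_const ?card_ord //.
  by move=> j _; rewrite coef_poly ltnS (leq_trans _ iM) // -ltnS.
elim: t {tM} => [|t IHt]; first by rewrite big_ord1 divff // pnatr_eq0.
by rewrite big_ord_recr IHt /= !natrM -![in RHS]natr1 -![in LHS]natr1; field.
Qed.

End TruncatedSeries.

(** * The Euler product of F[x] and the sieve sum *)

Section PrimeSeries.
Variables (R : realFieldType) (F : finFieldType) (M : nat).
Local Notation q := #|F|.
Local Notation T := {poly_M.+1 F}.

Definition nrm (p : {poly F}) : R := q%:R ^+ deg p.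

Lemma qR_gt1 : 1 < q%:R :> R.
Proof. by rewrite ltr1n q_gt1. Qed.

Lemma nrm_gt0 p : 0 < nrm p.
Proof. by rewrite exprn_gt0 // (lt_trans ltr01) // qR_gt1. Qed.

Lemma nrm_gt1 p : mirr p -> 1 < nrm p.
Proof. by move=> hp; rewrite exprn_egt1 ?qR_gt1 // -lt0n mirr_deg_gt0. Qed.

Lemma nrmV_itv p : mirr p -> 0 <= (nrm p)^-1 < 1.
Proof. by move=> /nrm_gt1 h; rewrite invr_ge0 ltW ?nrm_gt0 //= invf_lt1 ?nrm_gt0. Qed.

Let P : {poly R} := \prod_(p : T | mirr p) (1 - (nrm p)^-1 *: 'X^(deg p)).

(** This is the inverse zeta function of F[x] in the variable X/q. By Gauss's formula its
    logarithmic derivative has coefficient -1 in every degree from 1 to M, and the resulting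
    recurrence has the only solution 1 - X. *)
Lemma prime_product_eqt : eqt M P (1 - 'X).
Proof.
pose L := \sum_(p : T | mirr p)
  (- \sum_(1 <= k < M.+1) ((deg p)%:R * (nrm p)^-1 ^+ k) *: 'X^(k * deg p)) : {poly R}.
have PL : log_deriv M P L.
  by apply: log_deriv_prod => p hp; apply/log_deriv_1subX/mirr_deg_gt0.
have L0 : L`_0 = 0.
  rewrite coef_sum big1 // => p hp; rewrite coefN coef_sum big_nat_cond big1 ?oppr0 //.
  move=> k /andP[/andP[k0 _] _]; rewrite coefZ coefXn ltn_eqF ?mulr0 //.
  by rewrite muln_gt0 k0 mirr_deg_gt0.
have L1 i : (0 < i <= M)%N -> L`_i = -1.
  move=> iM; rewrite coef_sum; under eq_bigr do rewrite coefN coef_sum.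
  rewrite sumrN; congr (- _); apply: (@mulIf _ (q%:R ^+ i)).
    by rewrite expf_neq0 // pnatr_eq0 -lt0n (ltn_trans _ (q_gt1 F)).
  rewrite mul1r -[RHS]natrX -(sum_deg_prime_power_degree F iM) natr_sum mulr_suml.
  apply: eq_bigr => p hp; rewrite natr_sum mulr_suml; apply: eq_bigr => k _.
  rewrite coefZ coefXn natrM; case: (eqVneq i (k * deg p)%N) => [->|_]; last by rewrite !(mulr0, mul0r).
  rewrite !mulr1 mulnC exprM -/(nrm p) exprVn mulfVK // expf_neq0 // gt_eqF ?nrm_gt0 //.
have P0 : P`_0 = 1.
  rewrite -horner_coef0 horner_prod big1 // => p hp; rewrite !hornerE.
  by rewrite expr0n gtn_eqF ?mirr_deg_gt0 // mulr0 subr0.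
have rec i : (i < M)%N -> (i.+1)%:R * P`_i.+1 = - \sum_(j < i.+1) P`_j.
  move=> iM; rewrite PL // coefM big_ord_recr /= subnn L0 mulr0 addr0 -sumrN.
  apply: eq_bigr => j _; have ji : (j <= i)%N by rewrite -ltnS.
  by rewrite L1 ?mulrN1 // subSn // ltnS (leq_ltn_trans (leq_subr _ _)).
have S0 i : (i.+1 <= M)%N -> \sum_(j < i.+2) P`_j = 0.
  elim: i => [|i IHi] iM.
    rewrite big_ord_recr big_ord1 /= P0; have := rec 0%N iM.
    by rewrite big_ord1 P0 mul1r => ->; rewrite subrr.
  rewrite big_ord_recr /= IHi ?(ltnW iM) // add0r.
  have := rec _ iM; rewrite IHi ?(ltnW iM) // oppr0 => /eqP.
  by rewrite mulf_eq0 pnatr_eq0 => /eqP.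
move=> i iM; rewrite coefB coef1 coefX; case: i iM => [|[|i]] iM; rewrite ?P0 ?subr0 //.
  by have := rec 0%N iM; rewrite big_ord1 P0 mul1r sub0r.
have := S0 i.+1 iM; rewrite big_ord_recr /= S0 ?(ltnW iM) // add0r => ->.
by rewrite /= ?subrr ?subr0.
Qed.

Lemma prime_geom_eqt :
  eqt M (\prod_(p : T | mirr p) geom M (nrm p)^-1 (deg p)) (ones R M).
Proof.
set G := \prod_(p | _) _.
have PG : eqt M ((1 - 'X) * G) 1.
  move=> i iM; rewrite -(eqtM prime_product_eqt (fun _ _ => erefl) iM) /P /G -big_split /=.
  transitivity ((\prod_(p : T | mirr p) 1 : {poly R})`_i); last by rewrite big1.
  by apply: eqt_prod iM => p /mirr_deg_gt0; apply: geom_inv.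
have G0 : G`_0 = 1.
  by have := PG 0%N isT; rewrite mulrBl mul1r coefB coefXM /= subr0 coef1.
have GS i : (i < M)%N -> G`_i.+1 = G`_i.
  move=> iM; have := PG _ iM; rewrite mulrBl mul1r coefB coefXM /= coef1 /= => /eqP.
  by rewrite subr_eq0 => /eqP.
move=> i iM; rewrite coef_poly ltnS iM.
by elim: i iM => // i IHi iM; rewrite GS // IHi // ltnW.
Qed.

(* The sum J of the large sieve, where one residue class is removed modulo the primes
   outside B and two modulo the primes in B. *)
Definition sieve_weight (B : pred T) (p : T) : R :=
  if B p then 2 / (nrm p - 2) else (nrm p - 1)^-1.

(** Squarefree moduli of degree at most M, encoded by their sets of prime factors. *)
Definition sieve_support (S : {set T}) : bool :=
  [forall (p | p \in S), mirr p] && (\sum_(p in S) deg p <= M)%N.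

(** The left side is the coefficient of X^M in 1/(1 - X)^3, two of whose factors are Euler products.
    Each squared Euler factor is replaced by a two-term factor al (1 + h X^deg p), h being the sieve
    weight, of at least the same mass. With N = |p|, this is an equality for al = (1 - 1/N)^-1
    outside B; inside B, with al = 1, it says N (N - 2) <= (N - 1)^2. Expanding over sets of primes
    gives the sieve sum. *)
Lemma sieve_sum_ge (B : pred T) : (forall p : T, mirr p -> B p -> 2 < nrm p) ->
  (M.+1 * M.+2)%:R / 2 <=
  (\sum_(S | sieve_support S) \prod_(p in S) sieve_weight B p) *
  \prod_(p : T | mirr p && ~~ B p) (1 - (nrm p)^-1)^-1.
Proof.
move=> hB; pose al p := if B p then 1 else (1 - (nrm p)^-1)^-1.
pose h := sieve_weight B.
have al1 (p : T) : mirr p -> 1 <= al p.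
  move=> hp; rewrite /al; case: ifP => // _; have := nrmV_itv hp.
  by move=> /andP[c0 c1]; rewrite invf_ge1 ?subr_gt0 // lerBlDr lerDl.
have h0 (p : T) : mirr p -> 0 <= h p.
  move=> hp; rewrite /h /sieve_weight; case: ifP => Bp; last by rewrite invr_ge0 subr_ge0 ltW ?nrm_gt1.
  by rewrite divr_ge0 // subr_ge0 ltW ?hB.
have alh (p : T) : mirr p -> (1 - (nrm p)^-1) ^- 2 <= al p + al p * h p.
  move=> hp; have N1 := nrm_gt1 hp; rewrite /al /h /sieve_weight.
  have N0 : nrm p != 0 by rewrite gt_eqF ?nrm_gt0.
  have N10 : nrm p - 1 != 0 by rewrite subr_eq0 gt_eqF.
  have -> : (1 - (nrm p)^-1) ^- 2 = nrm p ^+ 2 / (nrm p - 1) ^+ 2 by field; rewrite ?N0 ?N10.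
  case: ifP => Bp.
    have N2 := hB _ hp Bp.
    have -> : 1 + 1 * (2 / (nrm p - 2)) = nrm p / (nrm p - 2) by field; rewrite subr_eq0 gt_eqF.
    rewrite ler_pdivrMr ?exprn_gt0 ?subr_gt0 // mulrAC ler_pdivlMr ?subr_gt0 //.
    by nra.
  rewrite le_eqVlt; apply/orP; left; apply/eqP; field; rewrite ?N0 ?N10 //.
have := @prod_two_term_dominates R M _ (index_enum T) (fun p => mirr p) al
   (fun p => al p * h p) (fun p => (nrm p)^-1) (fun p => deg p) M (leqnn _)
   (fun p hp => nrmV_itv hp) al1 _ alh.
have -> : (ones R M * (\prod_(p : T | mirr p) geom M (nrm p)^-1 (deg p)) ^+ 2)`_M = (M.+1 * M.+2)%:R / 2.
  rewrite -(coef_ones_cubed R (leqnn M)) !expr2.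
  exact: (eqtM (fun _ _ => erefl) (eqtM prime_geom_eqt prime_geom_eqt)).
move=> /(_ _)/le_trans -> // => [p hp|]; first by rewrite mulr_ge0 ?h0 // (le_trans ler01) ?al1.
rewrite coef_ones_mul //.
have -> : \prod_(p : T | mirr p) ((al p)%:P + (al p * h p) *: 'X^(deg p)) =
   (\prod_(p : T | mirr p && ~~ B p) (1 - (nrm p)^-1)^-1) *:
   \sum_(S : {set T} | [forall (p | p \in S), mirr p]) (\prod_(p in S) h p) *: 'X^(\sum_(p in S) deg p).
  rewrite [in RHS]big_mkcondr /= -[RHS]mul_polyC rmorph_prod.
  rewrite (eq_bigr (fun p => (al p)%:P * (1 + h p *: 'X^(deg p)))); last first.
    by move=> p _; rewrite mulrDr mulr1 mul_polyC scalerA.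
  rewrite big_split /=; congr (_ * _).
    by apply: eq_bigr => p _; rewrite /al; case: (B p).
  rewrite big_mkcond /= (eq_bigr (fun p : T => (if mirr p then h p *: 'X^(deg p) else 0) + 1)); last first.
    by move=> p _; case: ifP; rewrite ?add0r // addrC.
  rewrite bigA_distr /= [RHS]big_mkcond /=; apply: eq_bigr => S _.
  rewrite -big_mkcond /=; case: ifP => [/forall_inP hS|/negbT].
    rewrite (eq_bigr (fun p : T => h p *: 'X^(deg p))) => [|p /hS -> //].
    by rewrite scaler_prod -expr_sum.
  rewrite negb_forall => /existsP[p]; rewrite negb_imply => /andP[pS np].
  by rewrite (bigD1 p) //= (negbTE np) mul0r.
under eq_bigr do rewrite coefZ coef_sum.
rewrite -mulr_sumr mulrC ler_wpM2r //.
  rewrite prodr_ge0 // => p /andP[hp _]; rewrite invr_ge0 subr_ge0.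
  by have /andP[_ /ltW] := nrmV_itv hp.
rewrite exchange_big /= /sieve_support big_mkcondr /=; rewrite le_eqVlt; apply/orP; left; apply/eqP; apply: eq_bigr => S hS.
under eq_bigr do rewrite coefZ coefXn.
rewrite -mulr_sumr; set D := (\sum_(p in S) deg p)%N.
case: ifP => hD.
  rewrite (bigD1 (Ordinal (hD : (D < M.+1)%N))) //= eqxx [X in _ + X]big1 ?addr0 ?mulr1 // => i.
  by rewrite -val_eqE /= => /negbTE ->.
rewrite [X in _ * X]big1 ?mulr0 // => i _; case: eqP => // e; move: (ltn_ord i).
by rewrite e ltnS hD.
Qed.

End PrimeSeries.

(** * The large sieve *)

Section LargeSieve.
Variables (R : realFieldType) (F : finFieldType).
Local Notation q := #|F|.

Lemma sum_shift n (b d : {poly F}) (f : {poly F} -> R) : (size d <= n)%N ->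
  \sum_(c : {poly_n F}) f (b + c + d) = \sum_(c : {poly_n F}) f (b + c).
Proof.
move=> sd; pose d' : {poly_n F} := NPoly sd.
rewrite [RHS](reindex_inj (addIr d')) /=.
by apply: eq_bigr => c _; rewrite -addrA.
Qed.

Lemma sum_residues (e p x : {poly F}) (f : {poly F} -> R) : p != 0 ->
  coprimep e p -> (forall x y, f (x + p * y) = f x) ->
  \sum_(s : {poly_(deg p) F}) f (x + e * (s : {poly F})) = \sum_(s : {poly_(deg p) F}) f s.
Proof.
move=> p0 ep fp.
have sm y : (size (y %% p)%R <= deg p)%N by rewrite -ltnS -size_deg // ltn_modp.
pose h (s : {poly_(deg p) F}) : {poly_(deg p) F} := NPoly (sm (x + e * (s : {poly F}))).
have hinj : injective h.
  move=> s s' [] /eqP; rewrite -subr_eq0 -modpN -modpD opprD addrACA subrr add0r -mulrBr.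
  rewrite -/(p %| _) Gauss_dvdpr 1?coprimep_sym // => ds.
  apply/val_inj/eqP; rewrite /= -subr_eq0; apply: contraLR ds => ss.
  apply/negP => /(dvdp_leq ss); rewrite leqNgt => /negP; apply.
  rewrite (size_deg p0) ltnS.
  exact: (size_npoly (s - s')).
rewrite [RHS](reindex_inj hinj) /=; apply: eq_bigr => s _.
by rewrite {1}(divp_eq (x + e * (s : {poly F})) p) addrC [_ * p]mulrC fp.
Qed.

(** Translations by e * s with deg s < deg p preserve the range of c because deg e + deg p <= n.
    They fix f, and as e is invertible modulo p they move g through all residues; averaging over s
    decouples the two functions. *)
Lemma sum_periodic_mul n (b e p : {poly F}) (f g : {poly F} -> R) :
  e != 0 -> p != 0 -> coprimep e p -> (deg e + deg p <= n)%N ->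
  (forall x y, f (x + e * y) = f x) -> (forall x y, g (x + p * y) = g x) ->
  (\sum_(c : {poly_n F}) f (b + c) * g (b + c)) * q%:R ^+ deg p =
  (\sum_(c : {poly_n F}) f (b + c)) * \sum_(s : {poly_(deg p) F}) g s.
Proof.
move=> e0 p0 ep dn fe gp.
rewrite -natrX -(@card_npoly F (deg p)) -sumr_const mulr_sumr.
transitivity (\sum_(s : {poly_(deg p) F}) \sum_(c : {poly_n F})
    f (b + c) * g (b + c + e * (s : {poly F}))).
  apply: eq_bigr => s _; rewrite mulr1 -(@sum_shift n b (e * (s : {poly F})) (fun x => f x * g x)).
    by apply: eq_bigr => c _; rewrite fe.
  have [->|s0] := eqVneq (s : {poly F}) 0; first by rewrite mulr0 size_poly0.
  rewrite size_mul // (size_deg e0) addSn /=; apply: leq_trans dn.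
  by rewrite leq_add2l size_npoly.
rewrite exchange_big mulr_suml; apply: eq_bigr => c _.
by rewrite -mulr_sumr (sum_residues (b + c) p0 ep gp).
Qed.

Definition mean (p : {poly F}) (f : {poly F} -> R) : R :=
  (nrm R p)^-1 * \sum_(s : {poly_(deg p) F}) f s.

Definition periodic (p : {poly F}) (f : {poly F} -> R) := forall x y, f (x + p * y) = f x.

Lemma periodic_dvd p e f : p %| e -> periodic p f -> periodic e f.
Proof. by move=> /dvdpP[d ->] h x y; rewrite mulrAC -mulrA mulrC -mulrA mulrC -mulrA h. Qed.

Lemma sum_periodic_prod m n (b : {poly F}) (s : seq {poly_m F})
    (f : {poly_m F} -> {poly F} -> R) :
  uniq s -> {in s, forall p : {poly_m F}, mirr p} -> {in s, forall p : {poly_m F}, periodic p (f p)} ->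
  (\sum_(p <- s) deg p <= n)%N ->
  \sum_(c : {poly_n F}) \prod_(p <- s) f p (b + c) =
  q%:R ^+ n * \prod_(p <- s) mean p (f p).
Proof.
elim: s => [|p s IHs] /=.
  move=> _ _ _ _; rewrite big_nil mulr1.
  by under eq_bigr do rewrite big_nil; rewrite sumr_const card_npoly natrX.
move=> /andP[ps us] hm hf; rewrite big_cons => hn.
have hms : {in s, forall p : {poly_m F}, mirr p} by move=> r rs; apply: hm; rewrite inE rs orbT.
have hfs : {in s, forall p : {poly_m F}, periodic p (f p)}.
  by move=> r rs; apply: hf; rewrite inE rs orbT.
have mp : mirr p by apply: hm; rewrite inE eqxx.
pose e : {poly F} := \prod_(r <- s) (r : {poly F}).
have e0 : e != 0 by rewrite /e prodf_seq_neq0; apply/allP => r /hms /mirr_neq0.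
have de : deg e = (\sum_(r <- s) deg r)%N.
  rewrite /e; elim: (s) hms => [|r s' IH] h; first by rewrite !big_nil /deg size_poly1.
  have h' : {in s', forall p : {poly_m F}, mirr p} by move=> t ts; apply: h; rewrite inE ts orbT.
  rewrite !big_cons degM ?IH //; first by apply: mirr_neq0; rewrite h ?mem_head.
  by rewrite prodf_seq_neq0; apply/allP => t /h' /mirr_neq0.
have ep : coprimep e p.
  rewrite coprimep_sym mirr_coprime // /e mirr_dvd_prod //; apply/hasPn => r' rs /=.
  rewrite -mirr_coprime // mirr_coprimeE ?(hms _ rs) //.
  by apply: contraNneq ps => pr; rewrite (val_inj pr : p = r') //.
pose Psi x := \prod_(r <- s) f r x.
have ePsi : periodic e Psi.
  move=> x y; apply: eq_big_seq => r rs.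
  have re : (r : {poly F}) %| e by rewrite /e (big_rem r rs) /= dvdp_mulIl.
  exact: (periodic_dvd re (hfs _ rs)).
have := @sum_periodic_mul n b e p Psi (f p) e0 (mirr_neq0 mp) ep _ ePsi (hf p (mem_head _ _)).
rewrite de addnC => /(_ hn); rewrite {1 2}/Psi (IHs us hms hfs); last first.
  by apply: leq_trans hn; apply: leq_addl.
move=> h; apply: (@mulIf _ (q%:R ^+ deg p)); first exact/lt0r_neq0/nrm_gt0.
rewrite (eq_bigr (fun c : {poly_n F} => Psi (b + c) * f p (b + c))) => [|c _]; last first.
  by rewrite big_cons mulrC.
rewrite h big_cons /mean -/(nrm R p); have := nrm_gt0 R p => /lt0r_neq0 N0.
by field.
Qed.

Variables (M n : nat) (om : {poly_M.+1 F} -> pred {poly F}).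
Local Notation T := {poly_M.+1 F}.
Hypothesis Mn : (M + M <= n)%N.
Hypothesis om_per : forall (p : T) x y, om p (x + (p : {poly F}) * y) = om p x.

Let nu (p : T) : R := #|[set r : {poly_(deg p) F} | om p (r : {poly F})]|%:R.
Hypothesis nu_gt0 : forall p : T, mirr p -> 0 < nu p.
Hypothesis nu_lt : forall p : T, mirr p -> nu p < nrm R p.

(** The value on the removed classes is the one that makes the mean zero. *)
Let phi (p : T) (f : {poly F}) : R := if om p f then - ((nrm R p - nu p) / nu p) else 1.
Let h (p : T) : R := nu p / (nrm R p - nu p).

Let mean_split (p : T) (u v : R) : mirr p ->
  mean p (fun f => if om p f then u else v) = (nrm R p)^-1 * (nu p * u + (nrm R p - nu p) * v).
Proof.
move=> mp; rewrite /mean; congr (_ * _); rewrite (bigID (fun s : {poly_(deg p) F} => om p s)) /=.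
congr (_ + _).
  rewrite (eq_bigr (fun=> u)) => [|s ->//]; rewrite sumr_const /nu cardsE.
  by rewrite mulr_natl.
rewrite (eq_bigr (fun=> v)) => [|s /negbTE->//]; rewrite sumr_const.
have -> : nrm R p - nu p = #|[set r : {poly_(deg p) F} | ~~ om p (r : {poly F})]|%:R.
  apply/eqP; rewrite subr_eq addrC -natrD /nrm -natrX -(@card_npoly F (deg p)).
  rewrite -(cardsC [set r : {poly_(deg p) F} | om p (r : {poly F})]) eqr_nat.
  by apply/eqP; congr (_ + #|pred_of_set _|)%N; apply/setP => r; rewrite !inE.
by rewrite cardsE mulr_natl.
Qed.

Let mean_phi (p : T) : mirr p -> mean p (phi p) = 0.
Proof.
move=> mp; rewrite mean_split //; have := nu_gt0 mp => /lt0r_neq0 n0.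
by rewrite mulrN mulrCA divff // !mulr1 addNr mulr0.
Qed.

Let mean_phi2 (p : T) : mirr p -> mean p (fun f => phi p f ^+ 2) = (h p)^-1.
Proof.
move=> mp; have := nu_gt0 mp => /lt0r_neq0 n0; have := nrm_gt0 R p => /lt0r_neq0 N0.
have Nn : nrm R p - nu p != 0 by rewrite subr_eq0 gt_eqF ?nu_lt.
transitivity (mean p (fun f => if om p f then (- ((nrm R p - nu p) / nu p)) ^+ 2 else 1)).
  by rewrite /mean; congr (_ * _); apply: eq_bigr => s _; rewrite /phi; case: ifP; rewrite ?expr1n.
by rewrite mean_split // /h; field; rewrite ?n0 ?N0 ?Nn.
Qed.

Let Phi (S : {set T}) (f : {poly F}) : R := \prod_(p in S) phi p f.

Let phi_per (p : T) : periodic p (phi p).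
Proof. by move=> x y; rewrite /phi om_per. Qed.

(** A prime in exactly one of S and S' contributes a factor of mean zero. The primes of the union
    have total degree at most 2M <= n, which is why the orthogonality is exact. *)
Let sum_PhiPhi (S S' : {set T}) : sieve_support S -> sieve_support S' ->
  \sum_(c : {poly_n F}) Phi S (mon c) * Phi S' (mon c) =
  if S == S' then q%:R ^+ n * \prod_(p in S) (h p)^-1 else 0.
Proof.
move=> /andP[/forall_inP hS dS] /andP[/forall_inP hS' dS'].
pose ch (p : T) f := (if p \in S then phi p f else 1) * (if p \in S' then phi p f else 1).
have hU p : p \in S :|: S' -> mirr p by rewrite inE => /orP[/hS|/hS'].
have e c : Phi S c * Phi S' c = \prod_(p <- enum (S :|: S')) ch p c.
  rewrite big_enum /= [RHS]big_split /= /Phi; congr (_ * _).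
    rewrite [LHS]big_mkcond [RHS]big_mkcond; apply: eq_bigr => p _; rewrite inE.
    by case: (p \in S); rewrite ?if_same.
  rewrite [LHS]big_mkcond [RHS]big_mkcond; apply: eq_bigr => p _; rewrite inE.
  by case: (p \in S'); rewrite ?if_same ?orbT.
rewrite (eq_bigr (fun c : {poly_n F} => \prod_(p <- enum (S :|: S')) ch p (mon c))) => [|c _]; last first.
  by rewrite e.
rewrite sum_periodic_prod ?enum_uniq //.
- rewrite big_enum /=; case: eqP => [SS|/eqP SS'].
    congr (_ * _); rewrite -SS finset.setUid; apply: eq_bigr => p pS.
    rewrite -mean_phi2 ?hS // /mean; congr (_ * _); apply: eq_bigr => s _.
    by rewrite /ch -SS pS expr2.
  have [p pU pd] : exists2 p, p \in S :|: S' & (p \in S) != (p \in S').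
    apply/exists_inP; apply: contraNT SS' => /exists_inPn H; apply/eqP/setP => p.
    case: (boolP (p \in S :|: S')) => [/H/negbNE/eqP//|].
    by rewrite inE negb_or => /andP[/negbTE-> /negbTE->].
  rewrite (bigD1 p pU) /=.
  have -> : mean p (ch p) = 0.
    rewrite -(mean_phi (hU _ pU)) /mean; congr (_ * _); apply: eq_bigr => s _.
    rewrite /ch; move: pd pU; rewrite inE.
    by case: (p \in S); case: (p \in S'); rewrite ?mulr1 ?mul1r.
  by rewrite mul0r mulr0.
- by move=> p; rewrite mem_enum => /hU.
- by move=> p _ x y; rewrite /ch phi_per.
rewrite big_enum /=; apply: leq_trans Mn; apply: leq_trans (leq_add dS dS').
rewrite big_mkcond [X in (_ <= X + _)%N]big_mkcond [X in (_ <= _ + X)%N]big_mkcond -big_split /=.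
by apply: leq_sum => p _; rewrite inE; case: (p \in S); case: (p \in S'); rewrite //= ?leq_addr // addn0.
Qed.

(* Bessel's inequality for the indicator of A and the orthogonal family Phi S, all of
   whose members equal 1 on A. *)
Lemma large_sieve (A : {set {poly_n F}}) :
  (forall c, c \in A -> forall p : T, mirr p -> ~~ om p (mon c)) ->
  #|A|%:R * (\sum_(S : {set T} | sieve_support S) \prod_(p in S) h p) <= q%:R ^+ n.
Proof.
move=> hA; set J := \sum_(S | _) _.
have qn0 : 0 < q%:R ^+ n :> R by rewrite exprn_gt0 // (lt_trans ltr01) ?qR_gt1.
have h0 (p : T) : mirr p -> 0 < h p by move=> mp; rewrite divr_gt0 ?nu_gt0 ?subr_gt0 ?nu_lt.
(* t * W is the orthogonal projection of the indicator of A on the span of the Phi S: its inner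
   product with Phi S is #|A|, and the squared norm of Phi S is q^n times the product of the (h
   p)^-1. *)
pose t : R := #|A|%:R / q%:R ^+ n.
pose W (c : {poly_n F}) : R := \sum_(S : {set T} | sieve_support S) (\prod_(p in S) h p) * Phi S (mon c).
have sA : \sum_(c : {poly_n F}) (c \in A)%:R * W c = #|A|%:R * J.
  rewrite -sum1_card natr_sum mulr_suml [RHS]big_mkcond /=; apply: eq_bigr => c _.
  case: ifP => cA; rewrite ?mul0r // !mul1r; apply: eq_bigr => S /andP[/forall_inP hS _].
  rewrite /Phi [X in _ * X]big1 ?mulr1 // => p pS.
  by rewrite /phi (negbTE (hA _ cA _ (hS _ pS))).
have sW : \sum_(c : {poly_n F}) W c ^+ 2 = q%:R ^+ n * J.
  under eq_bigr do rewrite expr2 /W mulr_suml.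
  rewrite exchange_big mulr_sumr /=; apply: eq_bigr => S hS.
  under eq_bigr do rewrite mulr_sumr.
  rewrite exchange_big (bigD1 S) //= [X in _ + X]big1 => [|S' /andP[hS' SS']].
    rewrite addr0 (eq_bigr (fun c => (\prod_(p in S) h p) ^+ 2 * (Phi S (mon c) * Phi S (mon c)))).
      rewrite -mulr_sumr sum_PhiPhi // eqxx prodfV.
      have P0 : \prod_(p in S) h p != 0.
        apply/prodf_neq0 => p pS; apply/lt0r_neq0/h0.
        by case/andP: hS => /forall_inP/(_ _ pS).
      by field.
    by move=> c _; ring.
  rewrite (eq_bigr (fun c => (\prod_(p in S) h p) * (\prod_(p in S') h p) * (Phi S (mon c) * Phi S' (mon c)))).
    by rewrite -mulr_sumr sum_PhiPhi // eq_sym (negbTE SS') mulr0.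
  by move=> c _; ring.
have pos : 0 <= \sum_(c : {poly_n F}) ((c \in A)%:R - t * W c) ^+ 2.
  by apply: sumr_ge0 => c _; rewrite sqr_ge0.
have e : \sum_(c : {poly_n F}) ((c \in A)%:R - t * W c) ^+ 2 =
   #|A|%:R - 2 * t * (#|A|%:R * J) + t ^+ 2 * (q%:R ^+ n * J).
  have sA1 : \sum_(c : {poly_n F}) (c \in A)%:R = #|A|%:R :> R.
    by rewrite -sum1_card natr_sum [RHS]big_mkcond /=; apply: eq_bigr => c _; case: ifP.
  rewrite -sA -sW -sA1 !mulr_sumr -sumrB -big_split /=; apply: eq_bigr => c _.
  by case: (c \in A) => /=; ring.
move: pos; rewrite e /t.
have [->|A0] := posnP #|A|; first by move=> _; rewrite mul0r ltW.
have A0' : 0 < #|A|%:R :> R by rewrite ltr0n.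
set a : R := #|A|%:R in A0' *; set Q := q%:R ^+ n in qn0 *.
have -> : a - 2 * (a / Q) * (a * J) + (a / Q) ^+ 2 * (Q * J) = a * (Q - a * J) / Q.
  by field; exact: lt0r_neq0.
by rewrite pmulr_lge0 ?invr_gt0 // pmulr_rge0 // subr_ge0.
Qed.

End LargeSieve.

(** * Pairs of primes with a fixed difference *)

Section TwinPrimes.
Variables (R : realFieldType) (F : finFieldType).
Local Notation q := #|F|.

(** The quotient of |a| by Euler's totient of a, restricted to the primes of degree at most M. *)
Definition totient_ratio M (a : {poly F}) : R :=
  \prod_(p : {poly_M.+1 F} | mirr p && (p %| a)) (1 - (nrm R p)^-1)^-1.

Definition twin_count n (a : {poly F}) : nat :=
  #|[set c : {poly_n F} | mirr (mon c) && mirr (mon c + a)]|.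

Lemma card_twin_residues (p a : {poly F}) : mirr p ->
  #|[set r : {poly_(deg p) F} | p %| (r : {poly F}) * ((r : {poly F}) + a)]| = (if ~~ (p %| a)%R then 2 else 1)%N.
Proof.
move=> mp; have p0 := mirr_neq0 mp.
have sm : (size ((- a) %% p)%R <= deg p)%N by rewrite -ltnS -size_deg // ltn_modp.
have small (r : {poly_(deg p) F}) : (p %| r) = (r == 0).
  apply/idP/idP => [pr|/eqP-> ]; last exact: dvdp0.
  apply: contraLR pr => r0; apply/negP => /(dvdp_leq r0); rewrite leqNgt => /negP; apply.
  by rewrite (size_deg p0) ltnS; apply: size_npoly.
have -> : [set r : {poly_(deg p) F} | p %| (r : {poly F}) * ((r : {poly F}) + a)] =
   [set 0; NPoly sm]%SET.
  apply/setP => r; rewrite !inE mirr_dvdM // small; congr (_ || _).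
  apply/idP/eqP => [pra|->].
    apply: val_inj; rewrite /= -[LHS](modp_small (q := p)).
      by apply/eqP; rewrite -subr_eq0 -modpN -modpD opprK.
    by rewrite (size_deg p0) ltnS; apply: size_npoly.
  by rewrite /= /dvdp modpD modp_id -modpD addNr mod0p.
have -> : (p %| a) = (0 == NPoly sm) by rewrite -dvdpNr /dvdp eq_sym -val_eqE.
by rewrite cards2; case: eqP.
Qed.

Lemma twin_count_le n (a : {poly F}) : (0 < n)%N -> (size a <= n)%N ->
  (twin_count n a)%:R <= 8 * q%:R ^+ n / n%:R ^+ 2 * totient_ratio n./2 a.
Proof.
move=> n0 sa; set M := n./2; pose T := {poly_M.+1 F}.
have qn0 : 0 < q%:R ^+ n :> R by rewrite exprn_gt0 // (lt_trans ltr01) ?qR_gt1.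
have tr0 : 0 < totient_ratio M a.
  by apply: prodr_gt0 => p /andP[/(nrmV_itv R)/andP[_ h] _]; rewrite invr_gt0 subr_gt0.
have n20 : 0 < n%:R ^+ 2 :> R by rewrite exprn_gt0 // ltr0n.
pose A := [set c : {poly_n F} | mirr (mon c) && mirr (mon c + a)].
pose om (p : T) : pred {poly F} := fun f => (p : {poly F}) %| f * (f + a).
have dT (p : T) : mirr p -> (deg p <= M)%N.
  by move=> mp; have := size_npoly p; rewrite (size_deg (mirr_neq0 mp)) ltnS.
have Aom c : c \in A -> forall p : T, mirr p -> ~~ om p (mon c).
  rewrite inE => /andP[m1 m2] p mp; have dp := dT p mp; have dp0 := mirr_deg_gt0 mp.
  have nd f : mirr f -> deg f = n -> ~~ ((p : {poly F}) %| f).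
    move=> mf df; apply/negP => /(mirr_dvd_eq mp mf) pf; move: df; rewrite -pf; lia.
  rewrite /om mirr_dvdM // negb_or nd ?deg_mon //= nd //.
  by rewrite /deg size_polyDl size_mon // ltnS.

have om_per (p : T) x y : om p (x + (p : {poly F}) * y) = om p x.
  rewrite /om (_ : _ * _ = x * (x + a) + (p : {poly F}) * (y * (x + a + (p : {poly F}) * y) + x * y)); last by ring.
  by rewrite dvdp_addl // dvdp_mulr.
(* If |p| = 2 and p does not divide a, the two removed classes are all residues modulo p, so the
   large sieve does not apply; but then one of f, f + a is always divisible by p and there is
   nothing to count. *)
have [[p [mp pa N2]]|Nok] := pselect (exists p : T, [/\ mirr p, ~~ ((p : {poly F}) %| a) & nrm R p <= 2]).
  suff -> : twin_count n a = 0%N.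
    by rewrite mulr_ge0 ?(ltW tr0) // divr_ge0 ?mulr_ge0 // ltW.
  apply/eqP; rewrite cards_eq0; apply/eqP/setP => c; rewrite [RHS]inE; apply/negP => cA.
  have := Aom c cA p mp; rewrite /om => /negP; apply.
  have sm : (size (mon c %% p)%R <= deg p)%N by rewrite -ltnS -size_deg ?ltn_modp // mirr_neq0.
  have : NPoly sm \in [set r : {poly_(deg p) F} | (p : {poly F}) %| (r : {poly F}) * ((r : {poly F}) + a)].
    have -> : [set r : {poly_(deg p) F} | (p : {poly F}) %| (r : {poly F}) * ((r : {poly F}) + a)] = [set: {poly_(deg p) F}].
      apply/eqP; rewrite eqEcard finset.subsetT card_twin_residues // pa cardsT card_npoly.
      by move: N2; rewrite /nrm -natrX ler_nat.
    by rewrite inE.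
  rewrite inE /= => h.
  have := om_per p (mon c %% p) (mon c %/ p); rewrite addrC [_ * (_ %/ _)]mulrC -divp_eq /om => ->.
  exact: h.
pose B (p : T) := ~~ ((p : {poly F}) %| a).
have hB (p : T) : mirr p -> B p -> 2 < nrm R p.
  by move=> mp Bp; rewrite ltNge; apply/negP => N2; apply: Nok; exists p.
have nuE (p : T) : mirr p -> #|[set r : {poly_(deg p) F} | om p (r : {poly F})]| = (if B p then 2 else 1)%N.
  by move=> mp; rewrite card_twin_residues.
have := @large_sieve R F M n om _ _ _ _ A Aom.
have -> : \sum_(S : {set T} | sieve_support S) \prod_(p in S)
   (#|[set r : {poly_(deg p) F} | om p (r : {poly F})]|%:R / (nrm R p - #|[set r : {poly_(deg p) F} | om p (r : {poly F})]|%:R)) =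
   \sum_(S : {set T} | sieve_support S) \prod_(p in S) sieve_weight R B p.
  apply: eq_bigr => S /andP[/forall_inP hS _]; apply: eq_bigr => p /hS mp.
  by rewrite nuE // /sieve_weight; case: (B p); rewrite ?div1r.
set J := \sum_(S | _) _ => hJ.
have {hJ} : #|A|%:R * J <= q%:R ^+ n.
  apply: hJ.
  - by rewrite /M; lia.
  - exact: om_per.
  - by move=> p mp; rewrite nuE // ltr0n; case: (B p).
  by move=> p mp; rewrite nuE //; case: ifP => // Bp; rewrite ?hB ?nrm_gt1.
have := sieve_sum_ge hB; rewrite -/J.
have -> : \prod_(p : T | mirr p && ~~ B p) (1 - (nrm R p)^-1)^-1 = totient_ratio M a.
  by apply: eq_bigl => p; rewrite /B negbK.
rewrite -/(twin_count n a) => h1 h2.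
have J0 : 0 < J.
  rewrite -(pmulr_lgt0 _ tr0); apply: lt_le_trans h1.
  by rewrite divr_gt0 // ltr0n.
(* Source of the 8: (M + 1)(M + 2) >= n^2/4 for M = [n./2]. *)
have h3 : n%:R ^+ 2 / 8 <= J * totient_ratio M a.
  apply: le_trans h1; rewrite ler_pdivrMr // mulrAC ler_pdivlMr // -!natrX -!natrM ler_nat.
  by rewrite /M; have := odd_double_half n; case: (odd n) => /=; nia.
have h4 : (twin_count n a)%:R * (n%:R ^+ 2 / 8) <= q%:R ^+ n * totient_ratio M a.
  apply: (le_trans (ler_wpM2l _ h3)) => //.
  by rewrite mulrA ler_wpM2r // ltW.
have -> : 8 * q%:R ^+ n / n%:R ^+ 2 * totient_ratio M a = (q%:R ^+ n * totient_ratio M a) / (n%:R ^+ 2 / 8).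
  by field; rewrite lt0r_neq0 // ltr0n.
by rewrite ler_pdivlMr // divr_gt0.
Qed.

End TwinPrimes.

(** * Averaging over exponents *)

Section Averaging.
Variables (R : realFieldType) (T : finType) (w : T -> R) (P : nat -> {set T}).
Hypothesis w_ge0 : forall p, 0 <= w p.
Hypothesis P_sub : forall i j, (0 < j < i)%N -> P i :&: P j \subset P (i - j).

Let V (X : {set T}) : R := \prod_(p in X) (1 + w p).
Let wt (S : {set T}) : R := \prod_(p in S) w p.
Let U e : {set T} := [set p | [exists i : 'I_e.+1, (0 < i)%N && (p \in P i)]].

Let V_expand X : V X = \sum_(S : {set T}) (S \subset X)%:R * wt S.
Proof.
rewrite /V big_mkcond /=.
rewrite (eq_bigr (fun p => (if p \in X then w p else 0) + 1)) => [|p _]; last first.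
  by case: ifP; rewrite ?add0r // addrC.
rewrite bigA_distr /=; apply: eq_bigr => S _; rewrite -big_mkcond /= /wt.
case: (boolP (S \subset X)) => [/fintype.subsetP SX|].
  by rewrite mul1r; apply: eq_bigr => p /SX ->.
case/fintype.subsetPn => p pS pX; rewrite mul0r (bigD1 p) //= (negbTE pX) mul0r //.
Qed.

(** Euclid's algorithm by repeated subtraction, which [P_sub] permits. *)
Let multiples_of_least (S : {set T}) e0 : (0 < e0)%N -> S \subset P e0 ->
  (forall j, (0 < j)%N -> S \subset P j -> (e0 <= j)%N) ->
  forall j, S \subset P j -> (e0 %| j)%N.
Proof.
move=> e00 Se mn j; elim: j {-2}j (leqnn j) => [|m IHm] j jm Sj.
  by move: jm; rewrite leqn0 => /eqP->.
have [->|j0] := posnP j; first exact: dvdn0.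
have ej := mn _ j0 Sj; have [<-|ne] := eqVneq e0 j; first exact: dvdnn.
rewrite -(dvdn_subl ej (dvdnn e0)); apply: IHm; first by lia.
apply: fintype.subset_trans (P_sub _); last by lia.
by rewrite finset.subsetI Sj.
Qed.

Lemma sum_inv_mulSn m n : (0 < m <= n)%N ->
  \sum_(m <= e < n) (e * e.+1)%:R^-1 = m%:R^-1 - n%:R^-1 :> R.
Proof.
move=> /andP[m0 mn]; rewrite -(subnKC mn); elim: (n - m)%N => [|k IHk].
  by rewrite addn0 big_geq ?subrr.
rewrite addnS big_nat_recr ?leq_addr //= IHk.
have h1 : (m + k)%:R != 0 :> R by rewrite pnatr_eq0; lia.
have h2 : (m + k).+1%:R != 0 :> R by rewrite pnatr_eq0.
rewrite natrM -[X in _ = _ - X^-1]natr1; rewrite -natr1 in h2 *.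
have h3 : m%:R != 0 :> R by rewrite pnatr_eq0; lia.
by move: h1 h2 h3; move: (m + k)%:R m%:R => a b h1 h2 h3; field; rewrite ?h1 ?h2 ?h3.
Qed.

Lemma sum_prod_average x :
  \sum_(1 <= j < x.+1) V (P j) <=
  x%:R * \sum_(1 <= e < x) V (U e) / (e * e.+1)%:R + V (U x).
Proof.
have wt0 S : 0 <= wt S by apply: prodr_ge0.
under eq_bigr do rewrite V_expand.
rewrite exchange_big /= mulr_sumr V_expand.
under [X in _ <= X + _]eq_bigr do rewrite V_expand mulr_suml mulr_sumr.
rewrite [X in _ <= X + _]exchange_big /= -big_split /=; apply: ler_sum => S _.
rewrite -mulr_suml.
rewrite [X in _ <= X + _](eq_bigr (fun e => x%:R * ((S \subset U e)%:R / (e * e.+1)%:R) * wt S)) => [|e _]; last by ring.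
rewrite -[X in _ <= X + _]mulr_suml -mulrDl ler_wpM2r // -mulr_sumr.
case: (pselect (exists j, (0 < j <= x)%N && (S \subset P j))) => [ex|nex]; last first.
  rewrite big_nat_cond big1 => [|j /andP[/andP[j0 jx] _]].
    by rewrite addr_ge0 ?mulr_ge0 ?sumr_ge0 // => e _; rewrite mulr_ge0 ?invr_ge0.
  by case: (boolP (S \subset P j)) => // Sj; case: nex; exists j; rewrite j0 -ltnS jx.
case: (ex_minnP ex) => e0 /andP[/andP[e00 e0x] Se0] mn.
have SU e : (e0 <= e)%N -> S \subset U e.
  move=> ee; apply: (fintype.subset_trans Se0); apply/fintype.subsetP => p pP.
  by rewrite inE; apply/existsP; exists (Ordinal (ee : (e0 < e.+1)%N)); rewrite e00.
have x0 : (0 < x)%N by apply: leq_trans e0x.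
apply: (@le_trans _ _ (x%:R / e0%:R)).
  rewrite ler_pdivlMr ?ltr0n // -natr_sum -natrM ler_nat.
  apply: leq_trans (leq_trunc_div x e0); rewrite leq_mul2r divn_count_dvd orbC.
  apply/orP; left; rewrite big_nat_cond [leqRHS]big_nat_cond.
  apply: leq_sum => j /andP[/andP[j0 jx] _].
  case: (boolP (S \subset P j)) => // Sj; rewrite (multiples_of_least e00 Se0 _ Sj) //.
  move=> i i0 Si; case: (leqP i x) => ix; first by apply: mn; rewrite i0 ix.
  by apply: leq_trans (ltnW ix).
rewrite SU // (@big_cat_nat _ _ _ e0) //=.
have h0 e : 0 <= (S \subset U e)%:R / (e * e.+1)%:R :> R by rewrite mulr_ge0 ?invr_ge0.
(* The count x / e0 is spread over all e from e0 to x by telescoping 1/(e (e + 1)); this is possible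
   because S stays inside U e for every e >= e0. *)
have -> : x%:R / e0%:R = x%:R * (e0%:R^-1 - x%:R^-1) + 1 :> R.
  by rewrite mulrBr divff ?pnatr_eq0 ?subrK // -lt0n.
rewrite lerD2r ler_wpM2l // -(@sum_inv_mulSn e0 x) ?e00 //.
apply: (@le_trans _ _ (\sum_(e0 <= i < x) (S \subset U i)%:R / (i * i.+1)%:R)).
  rewrite big_nat_cond [leRHS]big_nat_cond; apply: ler_sum => e /andP[/andP[ee _] _].
  by rewrite SU // mul1r.
by rewrite lerDr sumr_ge0.
Qed.

End Averaging.

(** * Prime divisors of g (g^j - 1) *)

Section Orders.
Variables (R : realFieldType) (F : finFieldType) (M : nat) (g : {poly F}).
Hypothesis g_deg : (0 < deg g)%N.

Definition power_product e : {poly F} := g * \prod_(1 <= i < e.+1) (g ^+ i - 1).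

Let g_neq0 : g != 0.
Proof. by apply: contraTneq g_deg => ->; rewrite /deg size_poly0. Qed.

Lemma deg_powersub1 i : (0 < i)%N -> deg (g ^+ i - 1) = (i * deg g)%N /\ g ^+ i - 1 != 0.
Proof.
move=> i0; have h : (1 < size (g ^+ i))%N.
  by rewrite size_deg ?expf_neq0 // degX // ltnS muln_gt0 i0.
have e : size (g ^+ i - 1) = size (g ^+ i).
  by rewrite size_polyDl // size_polyN size_poly1.
by rewrite /deg e -[(_).-1]/(deg _) degX // -size_poly_gt0 e (ltn_trans _ h).
Qed.

Lemma power_product_deg e :
  power_product e != 0 /\ (deg (power_product e) * 2 = deg g * (2 + e * e.+1))%N.
Proof.
suff [h1 h2] : \prod_(1 <= i < e.+1) (g ^+ i - 1) != 0 /\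
    (deg (\prod_(1 <= i < e.+1) (g ^+ i - 1)) * 2 = deg g * (e * e.+1))%N.
  by rewrite /power_product mulf_neq0 // degM // mulnDl h2; split => //; lia.
elim: e => [|e [IH1 IH2]]; first by rewrite big_nil /deg size_poly1 oner_neq0; split => //; lia.
have [d n] := deg_powersub1 (ltn0Sn e).
by rewrite big_nat_recr //= mulf_neq0 // degM // mulnDl IH2 d; split => //; nia.
Qed.

(** The form 1 + w required by [sum_prod_average]. The absolute value is harmless on primes and
    makes w nonnegative on the whole index type at once. *)
Lemma totient_ratioE (a : {poly F}) : totient_ratio R M a =
  \prod_(p in [set p : {poly_M.+1 F} | mirr p && ((p : {poly F}) %| a)]) (1 + `|(nrm R p - 1)^-1|).
Proof.
rewrite /totient_ratio big_set; apply: eq_bigr => p /andP[mp _].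
have N1 := nrm_gt1 R mp; have N0 := nrm_gt0 R p.
rewrite ger0_norm ?invr_ge0 ?subr_ge0 ?(ltW N1) //.
have h1 : nrm R p != 0 by rewrite gt_eqF.
have h2 : nrm R p - 1 != 0 by rewrite subr_eq0 gt_eqF.
by field; rewrite ?h1 ?h2.
Qed.

Lemma sum_totient_ratio x :
  \sum_(1 <= j < x.+1) totient_ratio R M (g * (g ^+ j - 1)) <=
  x%:R * \sum_(1 <= e < x) totient_ratio R M (power_product e) / (e * e.+1)%:R
  + totient_ratio R M (power_product x).
Proof.
have [->|x0] := posnP x.
  rewrite big_geq // mul0r add0r; apply: prodr_ge0 => p /andP[mp _].
  by rewrite invr_ge0 subr_ge0; have /andP[_ /ltW] := nrmV_itv R mp.
pose P j := [set p : {poly_M.+1 F} | mirr p && ((p : {poly F}) %| g * (g ^+ j - 1))].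
have Psub i j : (0 < j < i)%N -> P i :&: P j \subset P (i - j)%N.
  move=> /andP[j0 ji]; apply/fintype.subsetP => p; rewrite !inE => /andP[/andP[mp]].
  rewrite mp !mirr_dvdM //=; case: (boolP ((p : {poly F}) %| g)) => //= ng h1 h2.
  (* A prime not dividing g that divides g^i - 1 and g^j - 1 divides their difference g^j (g^(i-j) -
     1), hence the second factor. *)
  rewrite -(@Gauss_dvdpr _ _ (g ^+ j)); last first.
    by rewrite mirr_coprime // mirr_dvdX.
  have -> : g ^+ j * (g ^+ (i - j) - 1) = (g ^+ i - 1) - (g ^+ j - 1).
    by rewrite mulrBr -exprD subnKC ?(ltnW ji) // mulr1; ring.
  by rewrite dvdp_sub.
have := @sum_prod_average R _ (fun p : {poly_M.+1 F} => `|(nrm R p - 1)^-1|) P (fun=> normr_ge0 _) Psub x.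
rewrite (eq_bigr (fun j => totient_ratio R M (g * (g ^+ j - 1)))) => [|j _]; last by rewrite totient_ratioE.
move=> /le_trans -> //.
have UE e : (0 < e)%N -> totient_ratio R M (power_product e) = \prod_(p in [set p | [exists i : 'I_e.+1, (0 < i)%N && (p \in P i)]]) (1 + `|(nrm R p - 1)^-1|).
  move=> e0; rewrite totient_ratioE; apply: eq_bigl => p; rewrite !inE.
  apply/andP/existsP => [[mp]|[i /andP[i0]]].
    rewrite /power_product mirr_dvdM // mirr_dvd_prod // => /orP[pg|].
      by exists (Ordinal (e0 : (1 < e.+1)%N)); rewrite /= inE mp mirr_dvdM // pg.
    case/hasP => i; rewrite mem_index_iota => /andP[i0 ie] /= pi.
    by exists (Ordinal ie); rewrite i0 inE mp mirr_dvdM // pi orbT.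
  rewrite inE => /andP[mp]; rewrite mp /power_product !mirr_dvdM // => /orP[->//|pi].
  rewrite mirr_dvd_prod //; split=> //; apply/orP; right; apply/hasP; exists (i : nat) => //.
  by rewrite mem_index_iota i0 ltn_ord.
rewrite UE // lerD2r ler_wpM2l // big_nat_cond [leRHS]big_nat_cond.
by apply: ler_sum => e /andP[/andP[e0 _] _]; rewrite UE.
Qed.

End Orders.

(** * Real analysis and Euler's constant *)

Section Calculus.
Variable R : realType.
Implicit Types x y z : R.

Lemma is_derive_ge0_le (f df : R -> R) a b : a <= b ->
  (forall x, a <= x <= b -> is_derive x 1 f (df x)) ->
  (forall x, a <= x <= b -> 0 <= df x) -> f a <= f b.
Proof.
rewrite le_eqVlt => /orP[/eqP-> //|ab] fd df0.
have [] := @MVT R f df a b ab.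
- by move=> x; rewrite in_itv /= => /andP[/ltW ax /ltW xb]; apply: fd; rewrite ax.
- apply: derivable_within_continuous => x; rewrite in_itv /= => xab.
  by case: (fd x xab).
move=> c; rewrite in_itv /= => /andP[/ltW ac /ltW cb] e.
by rewrite -subr_ge0 e mulr_ge0 ?subr_ge0 ?(ltW ab) // df0 // ac.
Qed.

Lemma expR_ge_series n x : 0 <= x -> \sum_(0 <= k < n) x ^+ k / k`!%:R <= expR x.
Proof.
move=> x0; rewrite /expR; apply: (@nondecreasing_cvgn_le _ (series (exp_coeff x))).
  by apply: nondecreasing_series => k _ _; rewrite /exp_coeff /= divr_ge0 // exprn_ge0.
exact: is_cvg_series_exp_coeff.
Qed.

Lemma expR_ge_cubic x : 0 <= x -> 1 + x + x ^+ 2 / 2 + x ^+ 3 / 6 <= expR x.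
Proof.
move=> x0; apply: le_trans (expR_ge_series 4 x0).
rewrite !big_nat_recr //= big_geq // add0r expr0 expr1 !factS fact0.
by rewrite !divr1 /= le_eqVlt; apply/orP; left; apply/eqP; field.
Qed.

(** Separates an Euler factor into 1/|p|, to be summed over p | a only, and 1/|p|^2, to be summed
    over all primes. *)
Lemma invr_1subr_le_expR x : 0 <= x <= 2^-1 -> (1 - x)^-1 <= expR (x + x ^+ 2).
Proof.
move=> /andP[x0 x1]; have h : 0 < 1 - x by lra.
rewrite -[leLHS]mul1r ler_pdivrMr //.
have y0 : 0 <= x + x ^+ 2 by nra.
apply: (@le_trans _ _ ((1 + (x + x ^+ 2) + (x + x ^+ 2) ^+ 2 / 2) * (1 - x))).
  rewrite -subr_ge0.
  have -> : (1 + (x + x ^+ 2) + (x + x ^+ 2) ^+ 2 / 2) * (1 - x) - 1 = x ^+ 2 / 2 * (1 - x - x ^+ 2 - x ^+ 3) by field.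
  by rewrite mulr_ge0 ?divr_ge0 ?sqr_ge0 //; nra.
rewrite ler_wpM2r ?(ltW h) //; apply: le_trans (expR_ge_cubic y0).
by rewrite lerDl divr_ge0 // exprn_ge0.
Qed.

Lemma expR_sinh_ge x : 0 <= x -> 2 * x <= expR x - expR (- x).
Proof.
move=> x0; rewrite -subr_ge0.
pose f : R -> R := @expR R - (@expR R \o horner (- 'X)) - horner (2%:P * 'X).
have : f 0 <= f x.
  apply: (@is_derive_ge0_le f (fun y => expR y + expR (- y) - 2)) => // [y _|y _].
    have d1 := is_derive_poly (- 'X) y; have d2 := is_derive_poly (2%:P * 'X) y.
    rewrite /f; apply: is_derive_eq.
    by rewrite /GRing.scale /= !poly.derivE !hornerE; ring.
  have := expR_gt0 y; have := expRxMexpNx_1 y.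
  move: (expR y) (expR (- y)) => a b ab a0.
  have : 0 <= (a - 1) ^+ 2 / a by rewrite divr_ge0 ?sqr_ge0 // ltW.
  have -> : b = a^-1 by apply: (mulfI (lt0r_neq0 a0)); rewrite ab divff // lt0r_neq0.
  by have -> : (a - 1) ^+ 2 / a = a + a^-1 - 2 by field; rewrite lt0r_neq0.
by rewrite /f !fctE /= !hornerE ?oppr0 ?expR0 subrr ?mulr0 ?subr0 ?oppr0 ?addr0.
Qed.

(** [expR_sinh_ge] at ln x. Being accurate to second order at 1, it suffices for [triS_ln_le], where
    the bound x - 1 would be too large. *)
Lemma ln_le_half_sub x : 1 <= x -> ln x <= (x - x^-1) / 2.
Proof.
move=> x1; have x0 : 0 < x by lra.
have := expR_sinh_ge (ln_ge0 x1); rewrite expRN lnK ?posrE //; lra.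
Qed.

Lemma expR_le_frac x : 0 <= x < 1 -> expR (2 * x) <= (1 + x) / (1 - x).
Proof.
move=> /andP[x0 x1]; rewrite ler_pdivlMr ?subr_gt0 // -subr_ge0.
pose f : R -> R := horner (1 + 'X) - (@expR R \o horner (2%:P * 'X)) * horner (1 - 'X).
have : f 0 <= f x.
  apply: (@is_derive_ge0_le f (fun y => 1 - (1 - 2 * y) * expR (2 * y))) => // [y _|y _].
    have d1 := is_derive_poly (1 + 'X) y; have d2 := is_derive_poly (2%:P * 'X) y.
    have d3 := is_derive_poly (1 - 'X) y.
    rewrite /f; apply: is_derive_eq.
    rewrite /GRing.scale /= !(derivD, derivN, derivM, derivC, derivX, mul0r, add0r) !(hornerD, hornerN, hornerM, hornerC, hornerX); ring.
  have := expR_ge1Dx (- (2 * y)); have := expR_gt0 (2 * y); have := expRxMexpNx_1 (2 * y).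
  move: (expR (2 * y)) (expR (- (2 * y))) => a b ab a0 hb; nra.
by rewrite /f !fctE /= !hornerE ?mulr0 ?expR0 ?subr0 ?mulr1 ?addr0 subrr.
Qed.

(** The truncated series p has p'(x) (1 - x) = 1 - x^M, so exp(p(x)) (1 - x) has derivative -
    exp(p(x)) x^M and cannot exceed its value 1 at 0. *)
Lemma expR_log_series_le M y : 0 <= y < 1 ->
  expR (\sum_(1 <= d < M.+1) y ^+ d / d%:R) <= (1 - y)^-1.
Proof.
move=> /andP[y0 y1]; rewrite -[leRHS]mul1r ler_pdivlMr ?subr_gt0 // -subr_ge0.
pose p : {poly R} := \sum_(1 <= d < M.+1) d%:R^-1 *: 'X^d.
have pE x : p.[x] = \sum_(1 <= d < M.+1) x ^+ d / d%:R.
  by rewrite horner_sum; apply: eq_bigr => d _; rewrite hornerE hornerXn mulrC.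
have dpE x : p^`().[x] * (1 - x) = 1 - x ^+ M.
  rewrite /p; elim: M {p pE} => [|m IHm].
    by rewrite big_geq // deriv0 horner0 mul0r expr0 subrr.
  rewrite big_nat_recr //= derivD hornerD mulrDl IHm derivZ derivXn !hornerE hornerMn hornerXn.
  rewrite -[X in _ * X * _]mulr_natr mulrCA mulVf ?mulr1 ?pnatr_eq0 //.
  by rewrite exprS; ring.
pose f : R -> R := cst 1 - (@expR R \o horner p) * horner (1 - 'X).
have : f 0 <= f y.
  apply: (@is_derive_ge0_le f (fun x => expR p.[x] * x ^+ M)) => // [x _|x /andP[x0 _]].
    have d1 := is_derive_poly p x; have d2 := is_derive_poly (1 - 'X) x.
    rewrite /f; apply: is_derive_eq.
    rewrite /GRing.scale /= derivB derivC derivX !(hornerD, hornerN, hornerC, hornerX).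
    have := dpE x; move: p^`().[x] (expR _) (x ^+ M) => a b c h.
    by transitivity (b - b * (a * (1 - x))); [ring | rewrite h; ring].
  by rewrite mulr_ge0 ?expR_ge0 ?exprn_ge0.
rewrite /f !fctE /= !(hornerD, hornerN, hornerC, hornerX) subr0 mulr1 -pE.
have -> : p.[0] = 0.
  rewrite pE big_nat_cond big1 // => d /andP[/andP[d0 _] _].
  by rewrite expr0n gtn_eqF // mul0r.
by rewrite expR0 subrr.
Qed.

End Calculus.

(** * Harmonic numbers and Euler's constant *)

Section EulerGamma.
Variable R : realType.

Definition harmonic_sum (m : nat) : R := \sum_(0 <= k < m) (k.+1%:R)^-1.

Lemma harmonic_sumS m : harmonic_sum m.+1 = harmonic_sum m + (m.+1%:R)^-1.
Proof. by rewrite /harmonic_sum big_nat_recr. Qed.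

Let shifted_ln (c : R) m : R := harmonic_sum m - ln (m%:R + c).

Let shifted_lnS_diff c m : 0 < c ->
  shifted_ln c m.+1 - shifted_ln c m = (m.+1%:R)^-1 - ln (1 + (m%:R + c)^-1).
Proof.
move=> c0; rewrite /shifted_ln harmonic_sumS.
have m0 : 0 < m%:R + c by rewrite ltr_wpDl.
have -> : 1 + (m%:R + c)^-1 = (m.+1%:R + c) / (m%:R + c).
  by rewrite -natr1; field; rewrite lt0r_neq0.
by rewrite ln_div ?posrE ?ltr_wpDl //; ring.
Qed.

(** With the shift 1/2 the sequence H_m - ln(m + c) decreases, while with 11/20 it increases from m
    = 1 on and so bounds gamma from below. The value 11/20 also keeps exp(gamma) c1 <= 1, which
    yields the summand 1 in [expR_harmonic_le]. *)
Let c1 : R := 11 / 20.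
Let c2 : R := 1 / 2.

Lemma shifted_ln_nondecreasing m n : (0 < m <= n)%N -> shifted_ln c1 m <= shifted_ln c1 n.
Proof.
move=> /andP[m0 /subnKC <-]; elim: (n - m)%N => [|k IHk]; first by rewrite addn0.
apply: le_trans IHk _; rewrite addnS -subr_ge0 shifted_lnS_diff ?divr_gt0 //.
set j := (m + k)%N; have j1 : 1 <= j%:R :> R by rewrite ler1n /j; lia.
rewrite subr_ge0 -ler_expR lnK ?posrE; last by rewrite addr_gt0 ?invr_gt0 ?addr_gt0 ?divr_gt0 //; lra.
rewrite -natr1 -/j; set z := (j%:R + 1)^-1.
have z0 : 0 < z by rewrite invr_gt0; lra.
have zj : j%:R = z^-1 - 1 by rewrite /z invrK addrK.
have z1 : z <= 2^-1 by rewrite lef_pV2 ?posrE //; lra.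
have -> : 1 + (j%:R + c1)^-1 = 1 + z / (1 - 9 / 20 * z).
  by rewrite zj /c1; field; apply/andP; split; lra.
apply: le_trans (expR_ge_cubic (ltW z0)).
rewrite -!addrA lerD2l ler_pdivrMr; last by lra.
rewrite -subr_ge0.
have -> : (z + (z ^+ 2 / 2 + z ^+ 3 / 6)) * (1 - 9 / 20 * z) - z =
   z ^+ 2 * (1 / 20 - 7 / 120 * z - 3 / 40 * z ^+ 2) by field.
by rewrite mulr_ge0 ?sqr_ge0 //; nra.
Qed.

Lemma shifted_ln_nonincreasing m n : (m <= n)%N -> shifted_ln c2 n <= shifted_ln c2 m.
Proof.
move=> /subnKC <-; elim: (n - m)%N => [|k IHk]; first by rewrite addn0.
apply: le_trans _ IHk; rewrite addnS -subr_le0 shifted_lnS_diff ?divr_gt0 //.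
set j := (m + k)%N; have j0 : 0 <= j%:R :> R by [].
have jc : 0 < (j%:R + c2)^-1 by rewrite invr_gt0 /c2; lra.
rewrite subr_le0 -ler_expR lnK ?posrE; last by lra.
pose x : R := (2 * (j%:R + 1))^-1.
have := @expR_le_frac R x.
have -> : 2 * x = j.+1%:R^-1 by rewrite /x -natr1; field; lra.
have -> : (1 + x) / (1 - x) = 1 + (j%:R + c2)^-1.
  by rewrite /x /c2; field; repeat (apply/andP; split); lra.
apply; rewrite /x invr_ge0; apply/andP; split; first by lra.
by rewrite invf_lt1; lra.
Qed.

Let u (N : nat) : R := \sum_(0 <= k < N) (k.+1%:R)^-1 - ln N%:R.

Let u_nonincreasing : nonincreasing_seq [sequence u n.+1]_n.
Proof.
apply/nonincreasing_seqP => n /=; rewrite /u big_nat_recr //= -subr_le0.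
have n0 : 0 < n.+1%:R :> R by [].
have : ln (1 + - (n.+2%:R)^-1) <= - (n.+2%:R)^-1 :> R.
  by apply: le_ln1Dx; rewrite ltrN2 invf_lt1 ?ltr1n.
have -> : 1 + - (n.+2%:R)^-1 = n.+1%:R / n.+2%:R :> R.
  by rewrite -[n.+2%:R]natr1; field; lra.
rewrite ln_div ?posrE //; move: (ln n.+1%:R) (ln n.+2%:R) (n.+2%:R^-1) (\sum_(0 <= _ < _) _).
move=> a b c d; lra.
Qed.

Let u_lower N m : (0 < m <= N)%N -> shifted_ln c1 m <= u N.
Proof.
move=> mN; apply: (le_trans (shifted_ln_nondecreasing mN)).
have N0 : 0 < N%:R :> R by rewrite ltr0n; lia.
rewrite /shifted_ln /u lerD2l lerN2 ler_ln ?posrE //; first by rewrite lerDl /c1; lra.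
by rewrite /c1; lra.
Qed.

Let u_cvg : cvgn u.
Proof.
have /cvg_ex[l ul] : cvgn [sequence u n.+1]_n.
  apply: nonincreasing_is_cvgn; first exact: u_nonincreasing.
  by exists (shifted_ln c1 1) => _ [n _ <-]; apply: u_lower.
by apply/cvg_ex; exists l; rewrite -cvg_shiftS.
Qed.

Let gamma_ge m : (0 < m)%N -> shifted_ln c1 m <= euler_gamma R.
Proof.
move=> m0; apply: limr_ge; first exact: u_cvg.
by exists m => // N /= mN; apply: u_lower; rewrite m0.
Qed.

Let gamma_le N : (0 < N)%N -> euler_gamma R <= u N.
Proof.
move=> N0; apply: limr_le; first exact: u_cvg.
exists N => // n /= Nn; have := u_nonincreasing (_ : (N.-1 <= n.-1)%N).
by rewrite /= !prednK ?(leq_trans N0) //; apply; lia.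
Qed.

(** The decreasing sequence with shift 1/2, compared at 200 and at 1, gives exp(gamma) <= (2/3)
    exp(1) exp(1/400), about 1.817 against 20/11 = 1.818...; the margin is small, hence the index
    200 and the sharp bound for exp(1). *)
Lemma expR_gamma_le : expR (euler_gamma R) <= 20 / 11.
Proof.
have h : euler_gamma R <= 1 - ln (3 / 2) + 1 / 400.
  apply: (le_trans (gamma_le (isT : (0 < 200)%N))).
  have := @shifted_ln_nonincreasing 1 200 isT; rewrite /shifted_ln /c2.
  have -> : harmonic_sum 1 = 1 by rewrite /harmonic_sum big_nat1 invr1.
  have -> : 1%:R + 1 / 2 = 3 / 2 :> R by lra.
  rewrite -/(harmonic_sum 200) /u -/(harmonic_sum 200).
  have -> : 200%:R + 1 / 2 = 200%:R * (1 + 1 / 400) :> R by lra.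
  rewrite lnM ?posrE; [|lra|lra].
  have := @le_ln1Dx R (1 / 400); lra.
apply: (@le_trans _ _ (expR (1 - ln (3 / 2) + 1 / 400))); first by rewrite ler_expR.
rewrite expRD expRB lnK ?posrE; last by lra.
have h1 : expR 1 <= (33 / 31 : R) ^+ 16.
  have -> : expR 1 = expR (2 * (1 / 32)) ^+ 16 :> R by rewrite -expRM_natl; congr expR; lra.
  rewrite lerXn2r ?nnegrE ?expR_ge0 ?divr_ge0 //.
  by apply: (le_trans (expR_le_frac _)); [apply/andP; split; lra | rewrite ler_pdivrMr; lra].
have h2 : expR (1 / 400) <= (801 / 799 : R).
  have -> : 1 / 400 = 2 * (1 / 800) :> R by lra.
  by apply: (le_trans (expR_le_frac _)); [apply/andP; split; lra | rewrite ler_pdivrMr; lra].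
have h3 : expR 1 * expR (1 / 400) <= (33 / 31 : R) ^+ 16 * (801 / 799).
  by rewrite ler_pM ?expR_ge0.
have h4 : (33 / 31 : R) ^+ 16 * (801 / 799) <= 30 / 11.
  have e2 : (33 / 31 : R) ^+ 2 <= 2833 / 2500 by lra.
  rewrite (exprM _ 2 8).
  apply: (@le_trans _ _ ((2833 / 2500) ^+ 8 * (801 / 799))); last by lra.
  by rewrite ler_wpM2r ?lerXn2r ?nnegrE ?sqr_ge0 ?divr_ge0 //; lra.
move: h3 h4; move: (expR 1) (expR (1 / 400)) => a b; lra.
Qed.

Lemma expR_harmonic_le m : (0 < m)%N ->
  expR (harmonic_sum m) <= 1 + expR (euler_gamma R) * m%:R.
Proof.
move=> m0; have mc : 0 < m%:R + c1 by rewrite addr_gt0 ?ltr0n // /c1; lra.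
apply: (@le_trans _ _ (expR (euler_gamma R + ln (m%:R + c1)))).
  by rewrite ler_expR -lerBlDr; apply: gamma_ge.
rewrite expRD lnK ?posrE // mulrDr addrC lerD2r /c1; have := expR_gamma_le; lra.
Qed.

End EulerGamma.

(** * Totient ratios *)

Section TotientRatioBound.
Variables (R : realType) (F : finFieldType) (M : nat).
Local Notation q := #|F|.
Local Notation T := {poly_M.+1 F}.
Let Q : R := q%:R.

Let Q_gt1 : 1 < Q. Proof. exact: qR_gt1. Qed.
Let Q_gt0 : 0 < Q. Proof. exact: lt_trans Q_gt1. Qed.

Lemma sum_deg_dvd (a : {poly F}) : a != 0 ->
  (\sum_(p : T | mirr p && ((p : {poly F}) %| a)%R) deg p <= deg a)%N.
Proof.
move=> a0; suff h (s : seq T) : uniq s -> all (fun p : T => mirr p && ((p : {poly F}) %| a)) s ->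
    let b := \prod_(p <- s) (p : {poly F}) in
    [/\ b != 0, b %| a & deg b = (\sum_(p <- s) deg p)%N].
  rewrite -big_filter; set s := seq.filter _ _.
  have [||b0 ba <-] := h s; last exact: dvdp_deg.
    by rewrite filter_uniq // index_enum_uniq.
  by apply/allP => p; rewrite mem_filter => /andP[].
elim: s => [|p s IHs] /=; first by rewrite !big_nil oner_neq0 dvd1p /deg size_poly1.
move=> /andP[ps us] /andP[/andP[mp pa] hs]; have [b0 ba db] := IHs us hs.
rewrite !big_cons; split.
- by rewrite mulf_neq0 // mirr_neq0.
- rewrite Gauss_dvdp ?pa // mirr_coprime // mirr_dvd_prod //.
  apply/hasPn => r rs /=; have /andP[mr _] := allP hs _ rs.
  rewrite -mirr_coprime // mirr_coprimeE //.
  by apply: contraNneq ps => pr; rewrite (val_inj pr : p = r).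
by rewrite degM ?(mirr_neq0 mp) // db.
Qed.

Lemma sum_mirr_le (f : nat -> R) (L : nat) : (forall d, 0 <= f d) ->
  (forall d, (L <= d)%N -> f d = 0) ->
  \sum_(p : T | mirr p) f (deg p) <= \sum_(1 <= d < L) Q ^+ d / d%:R * f d.
Proof.
move=> f0 fL.
have dT (p : T) : mirr p -> (deg p < M.+1)%N.
  by move=> mp; have := size_npoly p; rewrite (size_deg (mirr_neq0 mp)).
rewrite (partition_big (fun p : T => inord (deg p) : 'I_M.+1) xpredT) //=.
have termE (j : 'I_M.+1) : (0 < j)%N ->
    \sum_(p : T | mirr p && (inord (deg p) == j)) f (deg p) = (npi F j)%:R * f j.
  move=> j0; rewrite (eq_big (fun p : T => mirr p && (deg p == j)) (fun=> f j)) => [|p|p /andP[mp /eqP<-]].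
  - rewrite sumr_const -[LHS]mulr_natl; congr (_%:R * _).
    by have := @sum_mirr_deg F M j (fun=> 1%N) (ltn_ord j); rewrite sum_nat_const !muln1.
  - case: (boolP (mirr p)) => //= mp; apply/eqP/eqP => [<-|e]; first by rewrite inordK ?dT.
    by apply: val_inj; rewrite /= inordK ?dT.
  by rewrite inordK ?dT.
rewrite big_ord_recl big1 ?add0r => [|p /andP[mp]]; last first.
  by rewrite -val_eqE /= inordK ?dT // gtn_eqF // mirr_deg_gt0.
apply: (@le_trans _ _ (\sum_(i < M) (npi F i.+1)%:R * f i.+1)).
  by apply: ler_sum => i _; rewrite termE.
apply: (@le_trans _ _ (\sum_(1 <= d < M.+1) Q ^+ d / d%:R * f d)).
  rewrite big_add1 /= big_mkord; apply: ler_sum => i _; rewrite ler_wpM2r //.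
  by rewrite ler_pdivlMr // -natrX -natrM ler_nat mulnC npi_le.
have t0 d : 0 <= Q ^+ d / d%:R * f d by rewrite !mulr_ge0 ?invr_ge0 ?exprn_ge0 ?(ltW Q_gt0).
case: (leqP L M.+1) => LM.
  have [L0|L0] := posnP L.
    rewrite big1 => [|d _]; first by rewrite big_geq // L0.
    by rewrite fL ?mulr0 // L0.
  rewrite (@big_cat_nat _ _ _ L) //= [X in _ + X]big_nat_cond [X in _ + X]big1 ?addr0 //.
  by move=> d /andP[/andP[Ld _] _]; rewrite fL ?mulr0.
by rewrite [leRHS](@big_cat_nat _ _ _ M.+1) ?(ltnW LM) //= lerDl sumr_ge0.
Qed.

(** Duality for the problem of maximizing the sum of 1/|p| with total degree at most deg a. Each
    unit of degree is priced 1/mu, the value of 1/|p| per unit of degree at degree m. Only primes of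
    degree less than m exceed this price, and the excess f is summed over all of them with [npi_le].
    Every m gives a valid bound; the choice is made in [expR_interpolation_le]. *)
Lemma sum_inv_nrm_le (a : {poly F}) m : a != 0 -> (0 < m)%N ->
  \sum_(p : T | mirr p && ((p : {poly F}) %| a)) (nrm R p)^-1 <=
  harmonic_sum R m.-1 + ((deg a)%:R - \sum_(1 <= i < m) Q ^+ i) / (m%:R * Q ^+ m).
Proof.
move=> a0 m0; set mu := m%:R * Q ^+ m.
have mR : 0 < m%:R :> R by rewrite ltr0n.
have mu0 : 0 < mu by rewrite mulr_gt0 ?exprn_gt0.
pose f d : R := if (0 < d < m)%N then Q ^- d - d%:R / mu else 0.
have cmp d : (0 < d)%N -> (Q ^- d <= d%:R / mu) = (m%:R * Q ^+ m <= d%:R * Q ^+ d).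
  by move=> d0; rewrite ler_pdivlMr // mulrC ler_pdivrMr ?exprn_gt0.
have f0 d : 0 <= f d.
  rewrite /f; case: ifP => // /andP[d0 dm]; rewrite subr_ge0.
  rewrite -[Q ^- d]mul1r ler_pdivlMr ?exprn_gt0 // mulrAC ler_pdivrMr // mul1r.
  by rewrite ler_pM ?exprn_ge0 ?(ltW Q_gt0) ?ler_nat ?(ltnW dm) // ler_weXn2l ?(ltW Q_gt1) // ltnW.
have step (p : T) : mirr p -> (nrm R p)^-1 <= f (deg p) + (deg p)%:R / mu.
  move=> mp; have d0 := mirr_deg_gt0 mp; rewrite /f /nrm d0 /=; case: ltnP => h.
    by rewrite subrK.
  rewrite add0r cmp // ler_pM ?exprn_ge0 ?(ltW Q_gt0) ?ler_nat // ler_weXn2l //.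
  exact: ltW.
apply: (@le_trans _ _ (\sum_(p : T | mirr p && ((p : {poly F}) %| a)) (f (deg p) + (deg p)%:R / mu))).
  by apply: ler_sum => p /andP[mp _]; apply: step.
rewrite big_split /= -mulr_suml -natr_sum.
have h1 : \sum_(p : T | mirr p && ((p : {poly F}) %| a)) f (deg p) <=
    harmonic_sum R m.-1 - (\sum_(1 <= i < m) Q ^+ i) / mu.
  apply: (@le_trans _ _ (\sum_(p : T | mirr p) f (deg p))).
    by rewrite [leLHS]big_mkcondr; apply: ler_sum => p _; case: ifP.
  apply: (le_trans (@sum_mirr_le f m f0 _)).
    by move=> d md; rewrite /f [(d < m)%N]ltnNge md andbF.
  rewrite /harmonic_sum mulr_suml -[in X in \sum_(0 <= k < X.-1) _](prednK m0) /=.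
  rewrite -(big_add1 _ _ 0 m xpredT (fun k => k%:R^-1)) -sumrB.
  rewrite big_nat_cond [leRHS]big_nat_cond; apply: ler_sum => d /andP[dm _].
  rewrite /f dm; have [d0 _] := andP dm.
  have dR : d%:R != 0 :> R by rewrite pnatr_eq0 -lt0n.
  have Qd : Q ^+ d != 0 by rewrite expf_neq0 // lt0r_neq0.
  rewrite le_eqVlt; apply/orP; left; apply/eqP; field.
  by rewrite dR Qd lt0r_neq0.
apply: le_trans (lerD h1 (_ : _ <= (deg a)%:R / mu)) _.
  by rewrite ler_wpM2r ?invr_ge0 ?(ltW mu0) // ler_nat sum_deg_dvd.
by rewrite mulrBl; lra.
Qed.

(** The factor Q / (Q - 1) comes from the squares: by [npi_le] the sum of 1/|p|^2 over all primes of
    degree at most M is at most the truncated series of - log(1 - 1/Q). *)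
Lemma totient_ratio_le (a : {poly F}) m : a != 0 -> (0 < m)%N ->
  totient_ratio R M a <= Q / (Q - 1) *
  expR (harmonic_sum R m.-1 + ((deg a)%:R - \sum_(1 <= i < m) Q ^+ i) / (m%:R * Q ^+ m)).
Proof.
move=> a0 m0.
have halfN (p : T) : mirr p -> 0 <= (nrm R p)^-1 <= 2^-1.
  move=> mp; rewrite invr_ge0 (ltW (nrm_gt0 R p)) /= lef_pV2 ?posrE ?nrm_gt0 //.
  have q2 : 2 <= Q by rewrite ler_nat q_gt1.
  apply: (le_trans q2); rewrite /nrm -[X in X <= _]expr1 ler_weXn2l ?mirr_deg_gt0 //.
  exact: ltW.
apply: (@le_trans _ _ (\prod_(p : T | mirr p && ((p : {poly F}) %| a)) (expR ((nrm R p)^-1) * expR ((nrm R p)^-1 ^+ 2)))).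
  apply: ler_prod => p /andP[mp _]; rewrite -expRD invr_1subr_le_expR ?halfN // andbT.
  by rewrite invr_ge0 subr_ge0; have /andP[_ /ltW] := nrmV_itv R mp.
rewrite big_split /= -!expR_sum mulrC ler_pM ?expR_ge0 //; last first.
  by rewrite ler_expR sum_inv_nrm_le.
have y01 : 0 <= Q^-1 < 1 by rewrite invr_ge0 (ltW Q_gt0) invf_lt1.
apply: le_trans (_ : expR (\sum_(1 <= d < M.+1) Q^-1 ^+ d / d%:R) <= _); last first.
  apply: (le_trans (expR_log_series_le M y01)).
  rewrite le_eqVlt; apply/orP; left; apply/eqP; field.
  have Q0 : Q != 0 by rewrite lt0r_neq0.
  have Q1 : Q - 1 != 0 by rewrite subr_eq0 gt_eqF.
  by rewrite ?Q0 ?Q1.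
rewrite ler_expR.
pose f d : R := if (d < M.+1)%N then Q^-1 ^+ d ^+ 2 else 0.
apply: (@le_trans _ _ (\sum_(p : T | mirr p) f (deg p))).
  rewrite [leLHS]big_mkcondr; apply: ler_sum => p mp.
  rewrite /f; have := size_npoly p; rewrite (size_deg (mirr_neq0 mp)) => ->.
  by case: ifP => _; rewrite /nrm -?exprVn // !exprn_ge0 ?invr_ge0 ?(ltW Q_gt0).
apply: (le_trans (@sum_mirr_le f M.+1 _ _)).
- by move=> d; rewrite /f; case: ifP => // _; rewrite !exprn_ge0 ?invr_ge0 ?(ltW Q_gt0).
- by move=> d Md; rewrite /f ltnNge Md.
rewrite big_nat_cond [leRHS]big_nat_cond; apply: ler_sum => d /andP[/andP[d0 dM] _].
rewrite /f dM exprVn le_eqVlt; apply/orP; left; apply/eqP; field.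
by rewrite lt0r_neq0 ?ltr0n //= expf_neq0 // lt0r_neq0.
Qed.

End TotientRatioBound.

(** * Explicit bounds for the weighted means *)

Section GrowthBounds.
Variable R : realType.
Let G : R := expR (euler_gamma R).

Lemma expR_chord (a b th : R) : 0 <= th <= 1 ->
  expR (a + th * (b - a)) <= (1 - th) * expR a + th * expR b.
Proof.
move=> /andP[t0 t1]; set c := a + th * (b - a).
have tangent x : expR c * (1 + (x - c)) <= expR x.
  have -> : expR x = expR c * expR (x - c) by rewrite -expRD addrC subrK.
  by rewrite ler_wpM2l ?expR_ge0 // expR_ge1Dx.
have e : expR c = (1 - th) * (expR c * (1 + (a - c))) + th * (expR c * (1 + (b - c))).
  by rewrite /c; ring.
by rewrite {1}e lerD // ler_wpM2l ?tangent // subr_ge0.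
Qed.

Lemma ln_chord (x y th : R) : 0 < x -> 0 < y -> 0 <= th <= 1 ->
  (1 - th) * ln x + th * ln y <= ln ((1 - th) * x + th * y).
Proof.
move=> x0 y0 th01; have [t0 t1] := andP th01.
have c0 : 0 < (1 - th) * x + th * y.
  have : 0 < Num.min x y by rewrite lt_min x0.
  have : Num.min x y <= x by rewrite ge_min lexx.
  have : Num.min x y <= y by rewrite ge_min lexx orbT.
  by move: (Num.min x y) => z; nra.
rewrite -ler_expR lnK ?posrE //.
have -> : (1 - th) * ln x + th * ln y = ln x + th * (ln y - ln x) by ring.
by apply: (le_trans (expR_chord _ _ th01)); rewrite !lnK ?posrE.
Qed.

Lemma gamma_ge_8_5 : 8 / 5 <= G.
Proof.
have := expR_harmonic_le R (ltn0Sn 0).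
rewrite /harmonic_sum big_nat1 invr1 mulr1 -/G.
have := @expR_ge_cubic R 1 ler01; lra.
Qed.

Lemma expR1_le : expR 1 <= 1 + G.
Proof.
by have := expR_harmonic_le R (ltn0Sn 0); rewrite /harmonic_sum big_nat1 invr1 mulr1.
Qed.

Lemma expR_le_of_frac (x y : R) : 0 <= x < 1 -> (1 + x) <= y * (1 - x) -> expR (2 * x) <= y.
Proof.
move=> x01 h; apply: (le_trans (expR_le_frac x01)).
by rewrite ler_pdivrMr // subr_gt0; case/andP: x01.
Qed.

Let expR23 : expR (2 / 3) <= 2 :> R.
Proof.
have -> : 2 / 3 = 2 * (1 / 3) :> R by lra.
by apply: expR_le_of_frac; [apply/andP; split; lra | lra].
Qed.

Lemma ln2_ge : 2 / 3 <= ln 2 :> R.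
Proof. by rewrite -ler_expR lnK ?posrE. Qed.

Section Interpolation.
Variable q : nat.
Hypothesis q2 : (2 <= q)%N.
Let Q : R := q%:R.
(** The total degree of all primes of degree at most m if there were exactly Q^d/d of each degree d.
    At this degree the exponent of [totient_ratio_le] is the harmonic number H_m. *)
Let S m : R := \sum_(1 <= i < m.+1) Q ^+ i.

Let Q_ge2 : 2 <= Q. Proof. by rewrite ler_nat. Qed.
Let lnQ_gt0 : 0 < ln Q. Proof. by have Q2 := Q_ge2; rewrite ln_gt0 //; lra. Qed.

Let S_S m : S m.+1 = S m + Q ^+ m.+1.
Proof. by rewrite /S big_nat_recr. Qed.

Let ln_S_ge m : (0 < m)%N -> m%:R * ln Q <= ln (S m).
Proof.
have Q2 := Q_ge2; case: m => // m _; rewrite mulr_natl -lnXn; last by lra.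
have p0 : 0 < Q ^+ m.+1 by rewrite exprn_gt0 //; lra.
rewrite ler_ln ?posrE // ?S_S ?lerDr ?ltr_wpDl //;
  by rewrite sumr_ge0 // => i _; rewrite exprn_ge0 //; lra.
Qed.

(** The left side is convex and the right side concave in D, so the endpoints D = 2 and D = q
    suffice. At D = 1 the inequality fails, whence the lower limit 2. *)
Let small_deg (D : nat) : (2 <= D <= q)%N -> expR (D%:R / Q) <= 1 + G * (ln D%:R / ln Q).
Proof.
have Q2 := Q_ge2; move=> /andP[D2 Dq]; have DR : 2 <= D%:R :> R by rewrite ler_nat.
have DQ : D%:R <= Q by rewrite ler_nat.
have G0 := gamma_ge_8_5.
have hQ : expR (Q / Q) <= 1 + G * (ln Q / ln Q).
  rewrite !divff ?mulr1 ?expR1_le ?(lt0r_neq0 lnQ_gt0) //.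
  by apply: lt0r_neq0; lra.
have [qe|q3] := eqVneq q 2.
  have -> : D%:R = Q :> R by apply/eqP; rewrite eq_le DQ /= -[X in X <= _]/(q%:R) qe.
  exact: hQ.
have Q3 : 3 <= Q by rewrite ler_nat; lia.
have h2 : expR (2 / Q) <= 1 + G * (ln 2 / ln Q).
  (* For q = 3 the comparison of 2/Q with ln 2 / ln Q used below fails. Instead 5/8 <= ln 2 / ln 3,
     from 3^5 <= 2^8, and G * 5/8 >= 1. *)
  have [qe|q4] := eqVneq q 3.
    rewrite /Q qe; apply: (le_trans expR23).
    suff : 5 / 8 <= ln 2 / ln 3 :> R by move=> h; nra.
    rewrite ler_pdivlMr; last by rewrite ln_gt0 //; lra.
    have : ln (3 ^+ 5) <= ln (2 ^+ 8) :> R by rewrite ler_ln ?posrE ?exprn_gt0 //; lra.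
    by rewrite !lnXn // -[_ *+ 5]mulr_natr -[_ *+ 8]mulr_natr; lra.
  have q4' : (4 <= q)%N by lia.
  have c : expR (0 + 2 / Q * (1 - 0)) <= (1 - 2 / Q) * expR 0 + 2 / Q * expR 1.
    apply: expR_chord; apply/andP; split; first by rewrite divr_ge0 //; lra.
    by rewrite ler_pdivrMr ?mul1r //; lra.
  rewrite add0r subr0 mulr1 expR0 mulr1 in c; apply: (le_trans c).
  (* Equivalent to Q^2 <= 2^Q, true from 4 on. *)
  have l : 2 / Q <= ln 2 / ln Q.
    rewrite ler_pdivlMr // mulrAC ler_pdivrMr; last by lra.
    rewrite [2 * _]mulr_natl [ln 2 * _]mulr_natr -!lnXn //; last by lra.
    rewrite ler_ln ?posrE ?exprn_gt0 //; last by lra.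
    rewrite /Q -!natrX ler_nat.
    elim: (q) q4' => // k IHk; rewrite leq_eqVlt => /orP[/eqP<- //|k4].
    rewrite [(2 ^ k.+1)%N]expnS; apply: leq_trans (leq_mul (leqnn 2) (IHk k4)).
    by rewrite -!mulnn; nia.
  have := expR1_le; have : 0 <= 2 / Q by rewrite divr_ge0 //; lra.
  by move: (expR 1) (2 / Q) l => a b; nra.
pose th := (D%:R - 2) / (Q - 2).
have Q20 : 0 < Q - 2 by lra.
have th01 : 0 <= th <= 1.
  by rewrite /th divr_ge0 ?ler_pdivrMr ?mul1r //=; lra.
have Q0 : Q != 0 by apply: lt0r_neq0; lra.
have D2e : D%:R = (1 - th) * 2 + th * Q by rewrite /th; field; apply: lt0r_neq0.
have -> : D%:R / Q = 2 / Q + th * (Q / Q - 2 / Q) by rewrite {1}D2e; field.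
apply: (le_trans (expR_chord _ _ th01)).
have lnD : (1 - th) * ln 2 + th * ln Q <= ln D%:R by rewrite D2e ln_chord //; lra.
have : (1 - th) * (ln 2 / ln Q) + th * (ln Q / ln Q) <= ln D%:R / ln Q.
  by rewrite !mulrA -mulrDl ler_pM2r ?invr_gt0.
move: th01 h2 hQ => /andP[]; move: (ln 2 / ln Q) (ln Q / ln Q) (ln _ / ln Q) (expR _) (expR _).
by move=> *; nra.
Qed.

(** Convexity against concavity again: the exponent is linear in D, equal to H_m and H_(m+1) at the
    two ends, where [expR_harmonic_le] and S m >= Q^m settle the matter. *)
Let large_deg (D m : nat) : (0 < m)%N -> S m <= D%:R <= S m.+1 ->
  expR (harmonic_sum R m + (D%:R - S m) / (m.+1%:R * Q ^+ m.+1)) <= 1 + G * (ln D%:R / ln Q).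
Proof.
have Q2 := Q_ge2; move=> m0 /andP[SD DS]; have G0 := gamma_ge_8_5.
have p0 : 0 < Q ^+ m.+1 by rewrite exprn_gt0 //; lra.
pose th := (D%:R - S m) / Q ^+ m.+1.
have th01 : 0 <= th <= 1.
  by rewrite /th divr_ge0 ?subr_ge0 ?(ltW p0) //= ler_pdivrMr // mul1r lerBlDl -S_S.
have -> : harmonic_sum R m + (D%:R - S m) / (m.+1%:R * Q ^+ m.+1) =
   harmonic_sum R m + th * (harmonic_sum R m.+1 - harmonic_sum R m).
  have m1 : m.+1%:R != 0 :> R by rewrite pnatr_eq0.
  have p1 := lt0r_neq0 p0.
  by rewrite harmonic_sumS /th; move: m1 p1; move: (m.+1%:R) (Q ^+ m.+1) => u v u0 v0; field; rewrite ?u0 ?v0.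
apply: (le_trans (expR_chord _ _ th01)).
have hm := expR_harmonic_le R m0; have hm1 := expR_harmonic_le R (ltn0Sn m).
have S0 k : 0 <= S k by rewrite /S sumr_ge0 // => i _; rewrite exprn_ge0 //; lra.
have Sm0 : 0 < S m by case: (m) m0 => // k _; rewrite S_S ltr_wpDl // exprn_gt0 //; lra.
have De : D%:R = (1 - th) * S m + th * S m.+1 by rewrite S_S /th; field; rewrite lt0r_neq0.
have lnD : (1 - th) * ln (S m) + th * ln (S m.+1) <= ln D%:R.
  by rewrite De ln_chord // S_S addr_gt0.
have : m%:R + th <= ln D%:R / ln Q.
  rewrite ler_pdivlMr //; apply: le_trans lnD.
  have := ln_S_ge m0; have := ln_S_ge (ltn0Sn m); rewrite -[m.+1%:R]natr1.
  by case/andP: th01; move: (ln (S m)) (ln (S m.+1)) (ln Q) => *; nra.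
rewrite -[m.+1%:R]natr1 in hm1; case/andP: th01; move: hm hm1; rewrite -/G.
by move: (expR _) (expR _) (ln _ / _) => *; nra.
Qed.

Lemma expR_interpolation_le (D : nat) : (2 <= D)%N -> exists2 m, (0 < m)%N &
  expR (harmonic_sum R m.-1 + (D%:R - \sum_(1 <= i < m) Q ^+ i) / (m%:R * Q ^+ m)) <=
  1 + G * (ln D%:R / ln Q).
Proof.
have Q2 := Q_ge2; move=> D2; have ex : exists m, D%:R <= S m.
  exists D; elim: (D) => [|k IHk]; first by rewrite /S big_geq.
  rewrite S_S -natr1 lerD // exprn_ege1 //; lra.
case: (ex_minnP ex) => [[|[|m]] Dm mn].
- by move: Dm; rewrite /S big_geq // -[0]/(0%:R) ler_nat leqn0; case: (D) D2.
- exists 1%N => //; rewrite big_geq // subr0 mul1r expr1 /harmonic_sum big_geq // add0r.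
  by apply: small_deg; rewrite D2 -(ler_nat R); move: Dm; rewrite /S big_nat1 expr1.
exists m.+2 => //; apply: large_deg => //; rewrite Dm andbT ltW // ltNge; apply/negP => /mn.
by rewrite ltnn.
Qed.

End Interpolation.

End GrowthBounds.

(** * Weighted means of the logarithm of the degree *)

Section WeightedMean.
Variable R : realType.

(* By partial summation this is the sum over 1 <= e <= x of (b e - b (e - 1)) / e,
   with b 0 read as 0. *)
Definition order_mean (b : nat -> R) (x : nat) : R :=
  \sum_(1 <= e < x) b e / (e * e.+1)%:R + b x / x%:R.

Lemma order_mean1 b : order_mean b 1 = b 1%N.
Proof. by rewrite /order_mean big_geq // add0r divr1. Qed.

Lemma order_meanS b x : (0 < x)%N ->
  order_mean b x.+1 = order_mean b x + (b x.+1 - b x) / x.+1%:R.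
Proof.
move=> x0; rewrite /order_mean big_nat_recr //= natrM.
have h1 : x%:R != 0 :> R by rewrite pnatr_eq0 -lt0n.
have h2 : x.+1%:R != 0 :> R by rewrite pnatr_eq0.
rewrite -!addrA; congr (_ + _); rewrite -natr1 in h2 *.
by field; rewrite h1 h2.
Qed.

Lemma order_mean_le b c x : (0 < x)%N ->
  (forall e, (0 < e <= x)%N -> b e <= c e) -> order_mean b x <= order_mean c x.
Proof.
move=> x0 h; rewrite /order_mean lerD //; last by rewrite ler_wpM2r ?invr_ge0 ?h ?x0 /=.
rewrite big_nat_cond [leRHS]big_nat_cond; apply: ler_sum => e /andP[/andP[e0 ex] _].
by rewrite ler_wpM2r ?invr_ge0 ?h // e0 ltnW.
Qed.

Lemma order_mean_affine (u v : R) b x : (0 < x)%N ->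
  order_mean (fun e => u + v * b e) x = u + v * order_mean b x.
Proof.
case: x => // x _; elim: x => [|x IHx]; first by rewrite !order_mean1.
by rewrite order_meanS // IHx [in RHS]order_meanS //; ring.
Qed.

(* [tri e] counts, in units of deg g, the degree of g * prod_(i <= e) (g ^+ i - 1) *)
Definition tri (e : nat) : R := 1 + (e * e.+1)%:R / 2.

Lemma tri_gt0 e : 0 < tri e.
Proof. by rewrite ltr_pwDl // divr_ge0. Qed.

(** With e = x + 1 the left side is of order 2/e^2; it is compared with 2/(e^2 - 1/4), which
    telescopes. *)
Lemma triS_ln_le x : (0 < x)%N ->
  (ln (tri x.+1) - ln (tri x)) / x.+1%:R <= 2 / (x%:R + 1 / 2) - 2 / (x.+1%:R + 1 / 2).
Proof.
move=> x0; have X0 : 1 <= x%:R :> R by rewrite ler1n.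
rewrite -ln_div ?posrE ?tri_gt0 //.
have t0 := tri_gt0 x; have t1 := tri_gt0 x.+1.
have h : 1 <= tri x.+1 / tri x.
  rewrite ler_pdivlMr // mul1r /tri lerD2l; apply: ler_wpM2r; rewrite ?invr_ge0 ?ler_nat //; nia.
apply: (@le_trans _ _ ((tri x.+1 / tri x - (tri x.+1 / tri x)^-1) / 2 / x.+1%:R)).
  by rewrite ler_wpM2r ?invr_ge0 // ln_le_half_sub.
move: t0 t1 {h}; rewrite /tri !natrM -[x.+2%:R]natr1 -[x.+1%:R]natr1; move: (x%:R) X0 => X X0 t0 t1.
set e := X + 1; have e2 : 2 <= e by rewrite /e; lra.
have p1 : 0 < e ^+ 2 - e + 2 by nra.
have p2 : 0 < e ^+ 2 + e + 2 by nra.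
have -> : 1 + X * e / 2 = (e ^+ 2 - e + 2) / 2 by rewrite /e; field.
have -> : 1 + e * (e + 1) / 2 = (e ^+ 2 + e + 2) / 2 by field.
have -> : (((e ^+ 2 + e + 2) / 2 / ((e ^+ 2 - e + 2) / 2)) - ((e ^+ 2 + e + 2) / 2 / ((e ^+ 2 - e + 2) / 2))^-1) / 2 / e =
   (2 * e ^+ 2 + 4) / ((e ^+ 2 - e + 2) * (e ^+ 2 + e + 2)).
  by field; rewrite !lt0r_neq0 //; lra.
have -> : 2 / (X + 1 / 2) - 2 / (e + 1 / 2) = 2 / (e ^+ 2 - 1 / 4).
  rewrite /e; field; rewrite !lt0r_neq0 //; nra.
rewrite ler_pdivrMr ?mulr_gt0 // mulrAC ler_pdivlMr; last by nra.
rewrite -subr_ge0.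
have -> : 2 * ((e ^+ 2 - e + 2) * (e ^+ 2 + e + 2)) - (2 * e ^+ 2 + 4) * (e ^+ 2 - 1 / 4) =
  5 / 2 * e ^+ 2 + 9 by field.
by have := sqr_ge0 e; lra.
Qed.

Lemma order_mean_tri_tail (b : nat -> R) (v : R) X x : 0 <= v -> (0 < X <= x)%N ->
  (forall e, (X <= e)%N -> b e.+1 - b e = v * (ln (tri e.+1) - ln (tri e))) ->
  order_mean b x <= order_mean b X + v * (2 / (X%:R + 1 / 2) - 2 / (x%:R + 1 / 2)).
Proof.
move=> v0 /andP[X0 /subnKC <-] hb; elim: (x - X)%N => [|k IHk].
  by rewrite addn0 subrr mulr0 addr0.
have Xk : (0 < X + k)%N by rewrite addn_gt0 X0.
rewrite addnS order_meanS // hb ?leq_addr // -mulrA.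
have := ler_wpM2l v0 (triS_ln_le Xk); move: IHk.
move: ((_ - _) / _) (2 / _) (2 / _) (2 / _) (order_mean b _) (order_mean b _) => z c1 c2 c3 o1 o2.
lra.
Qed.

Lemma order_mean_mulSn x : (0 < x)%N -> order_mean (fun e => (e * e.+1)%:R) x = 2 * x%:R.
Proof.
case: x => // x _; elim: x => [|x IHx]; first by rewrite order_mean1 mulr1.
rewrite order_meanS // IHx -natrB ?leq_mul //.
have -> : (x.+2 * x.+3 - x.+1 * x.+2 = 2 * x.+2)%N by lia.
by rewrite natrM mulfK ?pnatr_eq0 // -[x.+2%:R]natr1; ring.
Qed.

(** Origin of the 6. The term 4/9 = 2/(4 + 1/2) bounds the whole tail after 4; starting the tail at
    3 would already exceed ln 6. After multiplication by 12 and exponentiation it is an inequality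
    between rational numbers. *)
Let order_mean4 : order_mean (fun e => ln (tri e)) 4 + 4 / 9 <= ln 6.
Proof.
rewrite (@order_meanS _ 3) // (@order_meanS _ 2) // (@order_meanS _ 1) // order_mean1.
have -> : tri 1 = 2 by rewrite /tri; lra.
have -> : tri 2 = 2 ^+ 2 by rewrite /tri; lra.
have -> : tri 3 = 7 by rewrite /tri; lra.
have -> : tri 4 = 11 by rewrite /tri; lra.
rewrite lnXn //.
have -> : 6 = 2 * 3 :> R by lra.
rewrite lnM ?posrE //.
suff : 16 / 3 + (ln 7 + 3 * ln 11) <= 2 * ln 2 + 12 * ln 3 :> R.
  move: (ln 2) (ln 7) (ln 11) (ln 3) => a b c d; rewrite -[a *+ 2]mulr_natr; lra.
have e1 : 7 * 11 ^+ 3 = expR (ln 7 + 3 * ln 11) :> R.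
  by rewrite expRD expRM_natl !lnK ?posrE.
have e2 : 2 ^+ 2 * 3 ^+ 12 = expR (2 * ln 2 + 12 * ln 3) :> R.
  by rewrite expRD !expRM_natl !lnK ?posrE.
rewrite -ler_expR expRD -e1 -e2.
have h : expR (16 / 3) <= (7 / 5) ^+ 16 :> R.
  have -> : expR (16 / 3) = expR (2 * (1 / 6)) ^+ 16 :> R by rewrite -expRM_natl; congr expR; lra.
  rewrite lerXn2r ?nnegrE ?expR_ge0 //; first lra.
  by apply: expR_le_of_frac; [apply/andP; split; lra | lra].
apply: (@le_trans _ _ ((7 / 5) ^+ 16 * (7 * 11 ^+ 3))); first by apply: ler_wpM2r => //; lra.
have : (7 / 5) ^+ 4 <= 97 / 25 :> R by lra.
move=> h4; apply: (@le_trans _ _ ((97 / 25) ^+ 4 * (7 * 11 ^+ 3))).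
  apply: ler_wpM2r; first lra.
  by rewrite (exprM _ 4 4) lerXn2r ?nnegrE ?exprn_ge0 ?divr_ge0 //; lra.
lra.
Qed.

Lemma order_mean_ln_tri_le x : (0 < x)%N -> order_mean (fun e => ln (tri e)) x <= ln 6.
Proof.
move=> x0; case: (leqP 4 x) => x4.
  apply: le_trans order_mean4.
  apply: (le_trans (@order_mean_tri_tail (fun e => ln (tri e)) 1 4 x ler01 x4 _)).
    by move=> e _; rewrite mul1r.
  have : 0 <= 2 / (x%:R + 1 / 2) :> R by rewrite divr_ge0 // addr_ge0 // divr_ge0.
  have -> : 2 / (4%:R + 1 / 2) = 4 / 9 :> R by field.
  by rewrite mul1r; lra.
have step k : (0 < k)%N -> order_mean (fun e => ln (tri e)) k <= order_mean (fun e => ln (tri e)) k.+1.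
  move=> k0; rewrite order_meanS // lerDl divr_ge0 // subr_ge0 ler_ln ?posrE ?tri_gt0 //.
  by rewrite /tri lerD2l; apply: ler_wpM2r; rewrite ?invr_ge0 ?ler_nat //; nia.
apply: (@le_trans _ _ (order_mean (fun e => ln (tri e)) 4)); last first.
  by have := order_mean4; lra.
move: x0 x4; case: x => [//|[|[|[|//]]]] _ _;
  by do ?[apply: (le_trans (step _ _)) => //]; rewrite ?lexx.
Qed.

End WeightedMean.

(** * The minimum of the two bounds *)

Section OrderMeanBound.
Variables (R : realType) (q d : nat).
Hypotheses (q_ge2 : (2 <= q)%N) (d_gt0 : (0 < d)%N).
Let G : R := expR (euler_gamma R).
Let Q : R := q%:R.
Let D : R := d%:R.
Let s : R := Num.sqrt (D / Q).

Let Q2 : 2 <= Q. Proof. by rewrite ler_nat. Qed.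
Let D1 : 1 <= D. Proof. by rewrite ler1n. Qed.
Let Q0 : 0 < Q. Proof. exact: lt_le_trans Q2. Qed.
Let D0 : 0 < D. Proof. exact: lt_le_trans D1. Qed.
Let lnQ_gt0 : 0 < ln Q. Proof. by rewrite ln_gt0 // (lt_le_trans _ Q2) // ltr1n. Qed.
Let s2 : s ^+ 2 = D / Q. Proof. by rewrite sqr_sqrtr // divr_ge0 // ltW. Qed.
Let s_gt0 : 0 < s. Proof. by rewrite sqrtr_gt0 divr_gt0. Qed.

Let ln_Dtri e : ln (D * tri R e) = ln D + ln (tri R e).
Proof. by rewrite lnM ?posrE ?tri_gt0. Qed.

Lemma order_mean_log_branch b x : (0 < x)%N ->
  (forall e, (0 < e <= x)%N -> b e <= 1 + G * (ln (D * tri R e) / ln Q)) ->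
  order_mean b x <= 1 + G * (ln (6 * D) / ln Q).
Proof.
move=> x0 hb; apply: (le_trans (order_mean_le x0 hb)).
have -> : (fun e => 1 + G * (ln (D * tri R e) / ln Q)) =
   (fun e => (1 + G / ln Q * ln D) + G / ln Q * ln (tri R e)).
  by apply/funext => e; rewrite ln_Dtri; ring.
rewrite order_mean_affine // lnM ?posrE // -addrA lerD2l.
have -> : G * ((ln 6 + ln D) / ln Q) = G / ln Q * ln D + G / ln Q * ln 6 by ring.
rewrite lerD2l ler_wpM2l ?order_mean_ln_tri_le //.
by rewrite divr_ge0 ?expR_ge0 // ltW.
Qed.

Lemma log_branch_le_sqrt_branch : Q < 25 * D -> ln (6 * D) / ln Q <= 5 * s.
Proof.
move=> h; have s5 : 1 <= 5 * s.
  rewrite -ler_sqr ?nnegrE ?mulr_ge0 ?(ltW s_gt0) // expr1n exprMn s2.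
  by rewrite mulrA ler_pdivlMr // mul1r; lra.
have -> : 6 * D = Q * (6 * s ^+ 2) by rewrite s2; field; exact: lt0r_neq0.
have p6 : 0 < 6 * s ^+ 2 by rewrite mulr_gt0 ?exprn_gt0.
rewrite lnM ?posrE // mulrDl divff ?lt0r_neq0 //.
have l6 : ln (6 * s ^+ 2) <= 10 / 3 * s - 21 / 25.
  (* The logarithm is bounded by its tangent at s = 3/5, whose slope 10/3 becomes exactly 5 after
     division by 2/3 <= ln Q. *)
  have -> : 6 * s ^+ 2 = 54 / 25 * (s / (3 / 5)) ^+ 2 by field.
  have r0 : 0 < s / (3 / 5) by rewrite divr_gt0 //; lra.
  have h54 : 0 < 54 / 25 :> R by lra.
  rewrite lnM ?posrE ?exprn_gt0 // lnXn // -[_ *+ 2]mulr_natr.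
  have a1 : ln (1 + (54 / 25 - 1)) <= 54 / 25 - 1 :> R by apply: le_ln1Dx; lra.
  have a2 : ln (1 + (s / (3 / 5) - 1)) <= s / (3 / 5) - 1.
    by apply: le_ln1Dx; lra.
  by rewrite !subrKC in a1 a2; lra.
have [n6|/ltW p] := lerP (ln (6 * s ^+ 2)) 0.
  have : ln (6 * s ^+ 2) / ln Q <= 0 by rewrite mulr_le0_ge0 ?invr_ge0 ?(ltW lnQ_gt0).
  by lra.
have lnq : 2 / 3 <= ln Q by apply: (le_trans (ln2_ge R)); rewrite ler_ln ?posrE.
have : ln (6 * s ^+ 2) / ln Q <= ln (6 * s ^+ 2) / (2 / 3).
  by rewrite ler_wpM2l // lef_pV2 ?posrE //; lra.
by lra.
Qed.

(** For e up to about 1/s the exponential bound is used, beyond it the logarithmic one. In units of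
    G s the initial range costs 2, the jump at X costs 27/20 and the tail costs 1, less than 5 in
    total; if x < X the cost is at most 4. *)
Lemma order_mean_sqrt_branch b x : (0 < x)%N -> 25 * D <= Q ->
  (forall e, (0 < e <= x)%N -> b e <= 1 + G * (ln (D * tri R e) / ln Q)) ->
  (forall e, (0 < e <= x)%N -> b e <= expR (D * tri R e / Q)) ->
  order_mean b x <= 1 + G * (5 * s).
Proof.
move=> x0 QD blog bexp.
have G8 : 8 / 5 <= G := gamma_ge_8_5 R.
have s15 : s <= 1 / 5.
  rewrite -(ler_pXn2r (n := 2)) ?nnegrE ?(ltW s_gt0) ?divr_ge0 // s2 ler_pdivrMr //; lra.
have si1 : 1 <= s^-1 by rewrite invf_ge1 //; lra.
pose X := (Num.truncn s^-1).+1.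
have /andP[X1 X2] : X%:R - 1 <= s^-1 < X%:R.
  have := @truncn_itv R s^-1; rewrite invr_ge0 (ltW s_gt0) => /(_ isT).
  by rewrite -[X%:R]natr1 addrK.
have sX : X%:R^-1 <= s.
  by rewrite -[s]invrK lef_pV2 ?posrE ?invr_gt0 ?ltr0n // ltW.
have triE e : (0 < e)%N -> tri R e <= e%:R * (e%:R + 1).
  move=> e0; rewrite /tri natrM -natr1; have : 1 <= e%:R :> R by rewrite ler1n.
  by move: (e%:R) => y; nra.
have bsmall e : (0 < e <= x)%N -> e%:R <= s^-1 -> b e <= 1 + 2 * G * s ^+ 2 * (e%:R * (e%:R + 1)).
  move=> ex es; have e0 : (0 < e)%N by case/andP: ex.
  have e1 : 1 <= e%:R :> R by rewrite ler1n.
  pose y := D * tri R e / Q.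
  have yle : y <= s ^+ 2 * (e%:R * (e%:R + 1)).
    by rewrite /y mulrAC -s2 ler_wpM2l ?sqr_ge0 // triE.
  have es1 : e%:R * s <= 1 by rewrite -ler_pdivlMr // mul1r.
  (* From e s <= 1 and s <= 1/5. On [0, 6/5] the chord of exp has slope at most (4 - 1)/(6/5) = 5/2,
     which is below 2 G. *)
  have y12 : y <= 6 / 5.
    apply: (le_trans yle); have -> : s ^+ 2 * (e%:R * (e%:R + 1)) = (e%:R * s) * (e%:R * s + s) by ring.
    have : 0 <= e%:R * s by rewrite mulr_ge0 // ltW.
    by move: es1 s15 s_gt0; move: (e%:R * s) (s) => u v; nra.
  have y0 : 0 <= y by rewrite !mulr_ge0 ?invr_ge0 // ?(ltW D0) ?(ltW Q0) // ltW // tri_gt0.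
  apply: (le_trans (bexp _ ex)); rewrite -/y.
  have c := @expR_chord R 0 (6 / 5) (y / (6 / 5)).
  have e4 : expR (6 / 5) <= 4 :> R.
    have -> : 6 / 5 = 2 * (3 / 5) :> R by lra.
    by apply: expR_le_of_frac; [apply/andP; split; lra | lra].
  have : expR (0 + y / (6 / 5) * (6 / 5 - 0)) <= (1 - y / (6 / 5)) * expR 0 + y / (6 / 5) * expR (6 / 5).
    by apply: c; apply/andP; split; lra.
  have -> : 0 + y / (6 / 5) * (6 / 5 - 0) = y by field.
  move/le_trans; apply; rewrite expR0.
  have h3 : y / (6 / 5) * expR (6 / 5) <= y / (6 / 5) * 4 by rewrite ler_wpM2l // divr_ge0 //; lra.
  have h5 : 5 / 2 * y <= 2 * G * (s ^+ 2 * (e%:R * (e%:R + 1))).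
    apply: (@le_trans _ _ (2 * G * y)); first by rewrite ler_wpM2r //; lra.
    by rewrite ler_wpM2l //; lra.
  by rewrite -[2 * G * s ^+ 2 * _]mulrA; lra.
have small_mean y : (0 < y)%N ->
    order_mean (fun e => 1 + 2 * G * s ^+ 2 * (e * e.+1)%:R) y = 1 + 4 * G * s ^+ 2 * y%:R.
  by move=> y0; rewrite order_mean_affine // order_mean_mulSn //; ring.
have [xX|Xx] := ltnP x X.
  have xs : x%:R <= s^-1.
    by apply: le_trans X1; rewrite lerBrDr natr1 ler_nat.
  apply: (@le_trans _ _ (1 + 4 * G * s ^+ 2 * x%:R)).
    rewrite -small_mean //; apply: order_mean_le => // e ex.
    rewrite natrM -[e.+1%:R]natr1; apply: bsmall => //.
    by apply: le_trans xs; rewrite ler_nat; case/andP: ex.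
  have : x%:R * s <= 1 by rewrite -ler_pdivlMr // mul1r.
  rewrite lerD2l; have : 0 < G * s by rewrite mulr_gt0 //; lra.
  have -> : 4 * G * s ^+ 2 * x%:R = 4 * (G * s) * (x%:R * s) by ring.
  rewrite [G * (5 * s)]mulrCA.
  by move: (G * s) (x%:R * s) => u v; nra.
pose c e := if (e < X)%N then 1 + 2 * G * s ^+ 2 * (e * e.+1)%:R else 1 + G * (ln (D * tri R e) / ln Q).
have bc e : (0 < e <= x)%N -> b e <= c e.
  move=> ex; rewrite /c; case: ltnP => eX; last exact: blog.
  rewrite natrM -[e.+1%:R]natr1; apply: bsmall => //.
  by apply: le_trans X1; rewrite lerBrDr natr1 ler_nat.
apply: (le_trans (order_mean_le x0 bc)).
have v0 : 0 <= G / ln Q by rewrite divr_ge0 ?expR_ge0 // ltW.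
apply: (le_trans (@order_mean_tri_tail R c (G / ln Q) X x v0 Xx _)).
  move=> e Xe; have n1 : (e < X)%N = false by apply/negbTE; rewrite -leqNgt.
  have n2 : (e.+1 < X)%N = false by apply/negbTE; rewrite -leqNgt leqW.
  by rewrite /c n1 n2 !ln_Dtri; ring.
have -> : order_mean c X = 1 + 2 * G * s ^+ 2 * (X%:R - 1) + G * (ln (D * tri R X) / ln Q) / X%:R.
  have := small_mean X isT; rewrite /order_mean.
  set S1 := \sum_(1 <= e < X) _; set S2 := \sum_(1 <= e < X) _.
  have -> : S2 = S1.
    rewrite /S1 /S2 big_nat_cond [RHS]big_nat_cond; apply: eq_bigr => e /andP[/andP[_ eX] _].
    by rewrite /c eX.
  move/(canRL (addrK _)) => ->; rewrite /c ltnn natrM -[X.+1%:R]natr1.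
  have X0 : X%:R != 0 :> R by rewrite pnatr_eq0.
  by field; rewrite X0 lt0r_neq0.
have lnQ2 : 2 <= ln Q.
  rewrite -ler_expR lnK ?posrE //.
  have e1 : expR 1 <= 3 :> R.
    have -> : 1 = 2 * (1 / 2) :> R by lra.
    by apply: expR_le_of_frac; [apply/andP; split; lra | lra].
  have -> : expR 2 = expR 1 ^+ 2 :> R by rewrite -expRM_natl mulr1.
  apply: (@le_trans _ _ (3 ^+ 2)); first by rewrite lerXn2r ?nnegrE ?expR_ge0.
  by have := D1; lra.
have XR : 1 <= X%:R :> R by rewrite ler1n.
have Xs : X%:R * s <= 1 + s.
  have : (X%:R - 1) * s <= 1 by rewrite -ler_pdivlMr // mul1r.
  by lra.
have L : ln (D * tri R X) / ln Q <= 27 / 20.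
  rewrite ler_pdivrMr ?(lt_le_trans _ lnQ2) //.
  have -> : D * tri R X = Q * (s ^+ 2 * tri R X) by rewrite s2; field; exact: lt0r_neq0.
  have p : 0 < s ^+ 2 * tri R X by rewrite mulr_gt0 ?exprn_gt0 ?tri_gt0.
  rewrite lnM ?posrE //.
  have h : s ^+ 2 * tri R X <= 42 / 25.
    apply: (@le_trans _ _ (s ^+ 2 * (X%:R * (X%:R + 1)))); first by rewrite ler_wpM2l ?sqr_ge0 ?triE.
    have -> : s ^+ 2 * (X%:R * (X%:R + 1)) = (X%:R * s) * (X%:R * s + s) by ring.
    have : 0 <= X%:R * s by rewrite mulr_ge0 // ltW.
    have := s_gt0; move: Xs s15; move: (X%:R * s) (s) => u v; nra.
  have a1 : ln (1 + (s ^+ 2 * tri R X - 1)) <= s ^+ 2 * tri R X - 1 by apply: le_ln1Dx; lra.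
  rewrite subrKC in a1; lra.
have t1 : 2 * G * s ^+ 2 * (X%:R - 1) <= 2 * (G * s).
  have : (X%:R - 1) * s <= 1 by rewrite -ler_pdivlMr // mul1r.
  have -> : 2 * G * s ^+ 2 * (X%:R - 1) = 2 * (G * s) * ((X%:R - 1) * s) by ring.
  have : 0 < G * s by rewrite mulr_gt0 //; lra.
  by move: (G * s) ((X%:R - 1) * s) => u v; nra.
have t2 : G * (ln (D * tri R X) / ln Q) / X%:R <= 27 / 20 * (G * s).
  apply: (@le_trans _ _ (G * (27 / 20) / X%:R)).
    by rewrite ler_wpM2r ?invr_ge0 // ler_wpM2l ?expR_ge0.
  have -> : 27 / 20 * (G * s) = G * (27 / 20) * s by ring.
  by rewrite ler_wpM2l // mulr_ge0 ?expR_ge0 //; lra.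
have t3 : G / ln Q * (2 / (X%:R + 1 / 2) - 2 / (x%:R + 1 / 2)) <= G * s.
  apply: (@le_trans _ _ (G / 2 * (2 * s))); last by rewrite le_eqVlt; apply/orP; left; apply/eqP; field.
  have x1 : 0 <= x%:R :> R by [].
  have i1 : (X%:R + 1 / 2)^-1 <= s by apply: le_trans sX; rewrite lef_pV2 ?posrE; lra.
  have i2 : 0 <= (x%:R + 1 / 2)^-1 :> R by rewrite invr_ge0; lra.
  apply: (@le_trans _ _ (G / ln Q * (2 * s))).
    by rewrite ler_wpM2l //; lra.
  rewrite ler_wpM2r ?mulr_ge0 ?(ltW s_gt0) // ler_wpM2l ?expR_ge0 // lef_pV2 ?posrE //.
have : 0 < G * s by rewrite mulr_gt0 //; lra.
rewrite [G * (5 * s)]mulrCA.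
by move: t1 t2 t3; move: (_ * (X%:R - 1)) (_ / X%:R) (G / _ * _) (G * s) => *; lra.
Qed.

(** The square root branch needs proof only when Q >= 25 D, that is, when 5 s <= 1; for smaller Q
    the logarithmic branch is already below it. *)
Lemma order_mean_min_le b x : (0 < x)%N ->
  (forall e, (0 < e <= x)%N -> b e <= 1 + G * (ln (D * tri R e) / ln Q)) ->
  (forall e, (0 < e <= x)%N -> b e <= expR (D * tri R e / Q)) ->
  order_mean b x <= 1 + G * Num.min (5 * s) (ln (6 * D) / ln Q).
Proof.
move=> x0 blog bexp; have h := order_mean_log_branch x0 blog.
case: (leP (5 * s) (ln (6 * D) / ln Q)) => // sl.
case: (leP (25 * D) Q) => QD; first exact: order_mean_sqrt_branch.
apply: (le_trans h); rewrite lerD2l ler_wpM2l ?expR_ge0 //.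
exact: log_branch_le_sqrt_branch.
Qed.

End OrderMeanBound.

(** * Counting representations *)

Section OffDiagonal.
Variables (R : realType) (F : finFieldType) (M : nat) (g : {poly F}).
Hypothesis g_deg : (0 < deg g)%N.
Local Notation q := #|F|.
Let Q : R := q%:R.
Let D : R := (deg g)%:R.

Definition mean_bound : R :=
  1 + expR (euler_gamma R) * Num.min (5 * Num.sqrt (D / Q)) (ln (6 * D) / ln Q).

Lemma mean_bound_ge0 : 0 <= mean_bound.
Proof.
have q1 : 1 < Q by exact: qR_gt1.
have d1 : 1 <= D by rewrite ler1n.
rewrite addr_ge0 // mulr_ge0 ?expR_ge0 // le_min mulr_ge0 ?sqrtr_ge0 //=.
by rewrite divr_ge0 // ln_ge0 //; lra.
Qed.

Lemma totient_ratio_sub (a b : {poly F}) :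
  (forall p, mirr p -> p %| a -> p %| b) -> totient_ratio R M a <= totient_ratio R M b.
Proof.
move=> ab; rewrite /totient_ratio big_mkcondr [leRHS]big_mkcondr /=.
apply: ler_prod => p mp; have /andP[c0 c1] := nrmV_itv R mp.
have i1 : 1 <= (1 - (nrm R p)^-1)^-1 by rewrite invf_ge1 ?subr_gt0 // lerBlDr lerDl.
have i0 : 0 <= (1 - (nrm R p)^-1)^-1 by apply: le_trans i1.
case: ifP => [pa|_]; first by rewrite (ab _ mp pa) i0 lexx.
by rewrite ler01; case: ifP => _; rewrite ?i1 ?lexx.
Qed.

Lemma sum_totient_ratio_le x :
  \sum_(1 <= j < x.+1) totient_ratio R M (g * (g ^+ j - 1)) <=
  x%:R * (Q / (Q - 1) * mean_bound).
Proof.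
have q1 : 1 < Q by exact: qR_gt1.
have [->|x0] := posnP x; first by rewrite big_geq // mul0r.
apply: (le_trans (sum_totient_ratio R M g x)).
have xR : x%:R != 0 :> R by rewrite pnatr_eq0 -lt0n.
pose b e := (Q - 1) / Q * totient_ratio R M (power_product g e).
have Q0 : Q != 0 by apply: lt0r_neq0; lra.
have Q1 : Q - 1 != 0 by apply: lt0r_neq0; lra.
have QQ : 0 < Q / (Q - 1) by rewrite divr_gt0 //; lra.
have -> : x%:R * (\sum_(1 <= e < x) totient_ratio R M (power_product g e) / (e * e.+1)%:R)
    + totient_ratio R M (power_product g x) = x%:R * (Q / (Q - 1) * order_mean b x).
  have -> : order_mean b x = (Q - 1) / Q *
      (\sum_(1 <= e < x) totient_ratio R M (power_product g e) / (e * e.+1)%:R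
       + totient_ratio R M (power_product g x) / x%:R).
    rewrite /order_mean /b mulrDr mulr_sumr !mulrA; congr (_ + _).
    by apply: eq_bigr => e _; rewrite !mulrA.
  by field; rewrite xR Q0 Q1.
rewrite ler_wpM2l // ler_wpM2l ?(ltW QQ) //.
have deg_tri e : (deg (power_product g e))%:R = D * tri R e.
  have [_ h] := power_product_deg g_deg e.
  have : (deg (power_product g e) * 2)%:R = (deg g * (2 + e * e.+1))%:R :> R by rewrite h.
  rewrite !natrM natrD => h2; apply: (@mulIf _ (2 : R)); first by rewrite pnatr_eq0.
  by rewrite h2 /tri natrM /D; field.
have bE e (Z : R) : totient_ratio R M (power_product g e) <= Q / (Q - 1) * Z -> b e <= Z.
  move=> h; rewrite /b.
  apply: (@le_trans _ _ ((Q - 1) / Q * (Q / (Q - 1) * Z))).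
    by rewrite ler_wpM2l // divr_ge0 //; lra.
  by rewrite le_eqVlt; apply/orP; left; apply/eqP; field; rewrite Q0 Q1.
apply: order_mean_min_le => //; first exact: q_gt1.
- move=> e /andP[e0 _]; have [pp0 h] := power_product_deg g_deg e.
  (* For e >= 1 the product contains both g and g - 1, so even deg g = 1 reaches the range of
     [expR_interpolation_le]. *)
  have d2 : (2 <= deg (power_product g e))%N by move: h; nia.
  have [m m0 hm] := @expR_interpolation_le R q (q_gt1 F) _ d2.
  apply: bE; rewrite -deg_tri.
  apply: (le_trans (totient_ratio_le R M pp0 m0)).
  by rewrite ler_wpM2l // ltW.
move=> e /andP[e0 _]; have [pp0 h] := power_product_deg g_deg e.
apply: bE; have := totient_ratio_le R M pp0 (ltn0Sn 0).
by rewrite big_geq // subr0 mul1r expr1 deg_tri /harmonic_sum big_geq // add0r.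
Qed.

End OffDiagonal.

(** The absolute value is needed because the quantity gets squared in the theorem and is negative
    when q^n < 4. For n >= 2 it is nonnegative, and for n = 1 every monic polynomial is prime, so
    that the quotient is at least 1. *)
Lemma npi_lower (R : realType) (F : finFieldType) (n : nat) : (0 < n)%N ->
  `|1 - 2 * (#|F|%:R : R) `^ (- (n%:R / 2))| <= n%:R * (npi F n)%:R / #|F|%:R ^+ n /\
  0 < n%:R * (npi F n)%:R / #|F|%:R ^+ n :> R.
Proof.
set q := #|F|; move=> n_gt0.
pose Q : R := q%:R; have Q1 : 1 < Q by exact: qR_gt1.
have Q2 : 2 <= Q by rewrite ler_nat q_gt1.
have Q0 : 0 < Q by lra.
have Qn : 0 < Q ^+ n by rewrite exprn_gt0.
have geo m : (\sum_(1 <= d < m.+1) q ^ d + 2 <= 2 * q ^ m)%N.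
  elim: m => [|m IHm]; first by rewrite big_geq.
  rewrite big_nat_recr //= expnS; have : (2 * q ^ m <= q * q ^ m)%N by rewrite leq_mul2r q_gt1 orbT.
  by move: IHm; move: (\sum_(1 <= d < _) _)%N (q ^ m)%N (q * _)%N => u v w; lia.
have lower : Q ^+ n + 2 <= n%:R * (npi F n)%:R + 2 * Q ^+ n./2.
  rewrite -!natrX -!natrM -!natrD ler_nat.
  have := npi_ge F n_gt0; have := geo n./2.
  move: (\sum_(1 <= d < _) _)%N (q ^ n)%N (q ^ n./2)%N (n * _)%N => a b c e; lia.
rewrite powRN; set y := Q `^ (n%:R / 2).
have yy : y ^+ 2 = Q ^+ n.
  by rewrite /y -powR_mulrn ?powR_ge0 // -powRrM divfK ?pnatr_eq0 // powR_mulrn // ltW.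
have y0 : 0 < y by rewrite powR_gt0.
have hy : Q ^+ n./2 <= y.
  rewrite -(ler_pXn2r (n := 2)) ?nnegrE ?exprn_ge0 ?(ltW Q0) ?(ltW y0) // yy -exprM.
  by rewrite ler_weXn2l ?(ltW Q1) // -{2}(odd_double_half n) -muln2 leq_addl.
have P0 : 0 < n%:R * (npi F n)%:R :> R.
  have : 2 * Q ^+ n./2 <= Q ^+ n + 1.
    case: (n) n_gt0 => [//|[|m]] _; first by rewrite expr0 expr1; lra.
    apply: (@le_trans _ _ (Q ^+ m.+2)); last by lra.
    have : Q ^+ 1 * Q ^+ (m.+2)./2 <= Q ^+ m.+2.
      by rewrite -exprD ler_weXn2l ?(ltW Q1) //; lia.
    rewrite expr1; apply: le_trans; rewrite ler_wpM2r // exprn_ge0 // ltW.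
  by lra.
split; last by rewrite divr_gt0.
have y1 : 1 <= y by rewrite -(ler_pXn2r (n := 2)) ?nnegrE ?(ltW y0) // expr1n yy exprn_ege1 // ltW.
rewrite -yy ler_pdivlMr ?exprn_gt0 //.
rewrite -[X in _ * X](@gtr0_norm _ (y ^+ 2)) ?exprn_gt0 // -normrM.
have -> : (1 - 2 / y) * y ^+ 2 = y ^+ 2 - 2 * y by field; exact: lt0r_neq0.
rewrite ler_norml; apply/andP; split; last by rewrite yy; lra.
rewrite lerNl opprB; case: (n) n_gt0 yy lower hy P0 y1 => [//|[|m]] _ yy lower hy P0 y1.
  by move: lower; rewrite expr0 !mul1r -yy; nra.
suff : 2 <= y by nra.
rewrite -(ler_pXn2r (n := 2)) ?nnegrE ?(ltW y0) // yy.
apply: (@le_trans _ _ (Q ^+ 2)); first by rewrite lerXn2r ?nnegrE // ltW.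
by rewrite ler_weXn2l // ltW.
Qed.

(** * First and second moments of the number of representations *)

Section Representations.
Variables (R : realType) (F : finFieldType) (g : {poly F}) (n : nat).
Hypothesis g_deg : (0 < deg g)%N.
Hypothesis n_gt0 : (0 < n)%N.
Local Notation q := #|F|.

Let g0 : g != 0.
Proof. by apply: contraTneq g_deg => ->; rewrite /deg size_poly0. Qed.

(** The number of admissible exponents: in f = h + g^k both f and h are monic of degree n, so g^k =
    f - h has degree less than n. *)
Definition num_exp : nat := ((n.-1 %/ deg g).+1)%N.
Local Notation K := num_exp.

Lemma lt_num_exp k : (k < K)%N = (k * deg g < n)%N.
Proof. by rewrite ltnS leq_divRL // -[in RHS](prednK n_gt0) ltnS. Qed.

Lemma num_exp_bounds : (n <= K * deg g)%N /\ (K * deg g <= n + deg g)%N.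
Proof.
rewrite /num_exp mulSn; split.
  by have := ltn_ceil n.-1 g_deg; rewrite mulSn; lia.
by have := leq_trunc_div n.-1 (deg g); lia.
Qed.

Lemma size_gX k : (k < K)%N -> (size (g ^+ k) <= n)%N.
Proof. by rewrite lt_num_exp size_deg ?expf_neq0 // degX. Qed.

Lemma card_shift (k : nat) (P : pred {poly F}) : (k < K)%N ->
  #|[set c : {poly_n F} | P (mon c - g ^+ k)]| = #|[set c : {poly_n F} | P (mon c)]|.
Proof.
move=> /size_gX sk; pose d : {poly_n F} := NPoly sk.
rewrite -[LHS](card_preimset _ (addIr d)); apply: eq_card => c; rewrite !inE /mon /=.
by congr (P _); rewrite addrA addrK.
Qed.

Definition reps (c : {poly_n F}) : nat := \sum_(k < K) mirr (mon c - g ^+ k).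

Lemma reps_gt0 c : (0 < reps c)%N = [exists k : 'I_K, mirr (mon c - g ^+ k)].
Proof.
rewrite /reps lt0n sum_nat_eq0 negb_forall; apply: eq_existsb => k.
by case: (mirr _).
Qed.

Lemma RcountE : Rcount n g = #|[set c : {poly_n F} | (0 < reps c)%N]|.
Proof.
have sm (c : {ffun 'I_n -> F}) : (size (\sum_(i < n) c i *: 'X^i)%R <= n)%N.
  rewrite (leq_trans (size_sum _ _ _)) //; apply/bigmax_leqP => i _.
  by rewrite (leq_trans (size_scale_leq _ _)) // size_polyXn ltn_ord.
pose phi (c : {ffun 'I_n -> F}) : {poly_n F} := NPoly (sm c).
have phi_coef c (i : 'I_n) : (phi c : {poly F})`_i = c i.
  rewrite /= coef_sum (bigD1 i) //= coefZ coefXn eqxx mulr1 big1 ?addr0 // => j ji.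
  by rewrite coefZ coefXn (_ : (_ == _) = false) ?mulr0 //; apply/negbTE; rewrite eq_sym.
have phi_inj : injective phi.
  by move=> c d e; apply/ffunP => i; rewrite -!phi_coef e.
have phi_ffun (c : {poly_n F}) : (c : {poly F}) = phi [ffun i : 'I_n => (c : {poly F})`_i].
  apply/polyP => j; case: (ltnP j n) => jn.
    by rewrite (phi_coef _ (Ordinal jn)) ffunE.
  by rewrite !nth_default // (leq_trans _ jn) ?size_npoly // sm.
rewrite /Rcount -(card_imset _ phi_inj); apply: eq_card => c; rewrite inE reps_gt0.
apply/imsetP/existsP => [[c0]|[k mk]].
  rewrite inE => /asboolP[h [k [mh sh ih e]]] ->.
  have [|d hd] := @monP F n h mh; first by rewrite /deg sh.
  have {}e : mon (phi c0) = h + g ^+ k by [].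
  have gk : g ^+ k = val (phi c0 - d) by rewrite -[LHS](addKr h) -e hd /mon /=; ring.
  have kK : (k < K)%N.
    by rewrite lt_num_exp -degX // -size_deg ?expf_neq0 // gk; apply: size_npoly.
  by exists (Ordinal kK); rewrite e addrK; apply/mirrP.
exists [ffun i : 'I_n => (c : {poly F})`_i].
  rewrite inE; apply/asboolP; exists (mon c - g ^+ k), k; case/mirrP: (mk) => mm im.
  split=> //.
    pose d : {poly_n F} := NPoly (size_gX (ltn_ord k)).
    have -> : mon c - g ^+ k = mon (c - d) by rewrite /mon /= addrA.
    exact: size_mon.
  rewrite subrK /monic_of /mon; congr (_ + _); exact/esym/phi_ffun.
exact/val_inj/phi_ffun.
Qed.

Lemma sum_reps : (\sum_(c : {poly_n F}) reps c = K * npi F n)%N.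
Proof.
rewrite /reps exchange_big /= -[K in RHS]card_ord -sum_nat_const; apply: eq_bigr => k _.
rewrite /npi -(card_shift (@mirr F) (ltn_ord k)) -sum1dep_card [RHS]big_mkcond /=.
by apply: eq_bigr => c _; case: (mirr _).
Qed.

Lemma Rcount_le : (Rcount n g <= K * npi F n)%N.
Proof.
rewrite RcountE -sum_reps -sum1dep_card big_mkcond /=.
by apply: leq_sum => c _; case: posnP.
Qed.

Let pair_count (k l : nat) : nat :=
  #|[set c : {poly_n F} | mirr (mon c - g ^+ k) && mirr (mon c - g ^+ l)]|.

Let W : R := q%:R / (q%:R - 1) * mean_bound R g.
Let C : R := 8 * q%:R ^+ n / n%:R ^+ 2.

(** The difference of the two primes is g^x - g^k = g^k (g^(x-k) - 1), whose prime divisors all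
    divide g (g^(x-k) - 1). *)
Let pair_count_le x k : (k < x)%N -> (x < K)%N ->
  (pair_count x k)%:R <= C * totient_ratio R n./2 (g * (g ^+ (x - k) - 1)).
Proof.
move=> kx xK.
have -> : pair_count x k = twin_count n (g ^+ x - g ^+ k).
  rewrite /twin_count -(card_shift (fun f => mirr f && mirr (f + (g ^+ x - g ^+ k))) xK).
  by apply: eq_card => c; rewrite !inE addrA subrK.
apply: (le_trans (twin_count_le R n_gt0 _)).
  rewrite (leq_trans (size_polyD _ _)) // size_polyN geq_max !size_gX //.
  exact: ltn_trans xK.
have C0 : 0 <= C by rewrite /C divr_ge0 ?mulr_ge0 ?exprn_ge0.
rewrite ler_wpM2l //; apply: totient_ratio_sub => p mp.
have -> : g ^+ x - g ^+ k = g ^+ k * (g ^+ (x - k) - 1).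
  by rewrite mulrBr mulr1 -exprD subnKC // ltnW.
rewrite !mirr_dvdM //; case: (k) => [|k']; last by rewrite mirr_dvdX.
by rewrite expr0 dvdp1; case/mirrP: mp => _ [sp _]; rewrite (gtn_eqF sp) /= => ->; rewrite orbT.
Qed.

(** Passing from x to x + 1 adds a diagonal entry, a row and an equal column. The differences in the
    row run through 1, ..., x, so the average over exponents bounds it by C x W, and 2 x <= (x +
    1)^2 - x^2. *)
Let sum_pair_count x : (x <= K)%N ->
  (\sum_(0 <= k < x) \sum_(0 <= l < x) pair_count k l)%:R <=
  x%:R * (npi F n)%:R + C * (x%:R ^+ 2 * W).
Proof.
elim: x => [|x IHx] xK.
  by rewrite big_geq // mul0r expr0n mul0r mulr0 addr0.
have row : (\sum_(0 <= l < x) pair_count x l)%:R <= C * (x%:R * W).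
  have C0 : 0 <= C by rewrite /C divr_ge0 ?mulr_ge0 ?exprn_ge0.
  apply: (@le_trans _ _ (\sum_(0 <= l < x) C * totient_ratio R n./2 (g * (g ^+ (x - l) - 1)))).
    rewrite natr_sum big_nat_cond [leRHS]big_nat_cond; apply: ler_sum => l /andP[/andP[_ lx] _].
    exact: pair_count_le.
  rewrite -mulr_sumr ler_wpM2l //; apply: le_trans (sum_totient_ratio_le R n./2 g_deg x).
  rewrite big_nat_rev add0n big_add1 /= big_nat_cond [leRHS]big_nat_cond.
  apply: ler_sum => l /andP[/andP[_ lx] _].
  by rewrite subKn.
have sym k l : pair_count k l = pair_count l k.
  by apply: eq_card => c; rewrite !inE andbC.
have diag : pair_count x x = npi F n.
  rewrite /npi -(card_shift (@mirr F) xK); apply: eq_card => c; rewrite !inE; exact: andbb.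
rewrite big_nat_recr //= (eq_bigr (fun k => \sum_(0 <= l < x) pair_count k l + pair_count x k)%N); last first.
  by move=> k _; rewrite big_nat_recr //= sym.
rewrite big_split /= big_nat_recr //= diag !natrD.
have := IHx (ltnW xK); have W0 : 0 <= C * W.
  rewrite mulr_ge0 ?divr_ge0 ?mulr_ge0 ?exprn_ge0 ?mean_bound_ge0 // ?invr_ge0 ?subr_ge0 ?ltW ?qR_gt1 //.
rewrite -[x.+1%:R]natr1.
have -> : C * ((x%:R + 1) ^+ 2 * W) = C * (x%:R ^+ 2 * W) + 2 * (C * (x%:R * W)) + C * W by ring.
rewrite mulrDl mul1r; move: row W0.
set a := (\sum_(0 <= l < x) _)%:R; set b := (\sum_(0 <= k < x) _)%:R.
move: (C * (x%:R * W)) (C * (x%:R ^+ 2 * W)) (C * W) (x%:R * _) (npi F n)%:R a b => *; lra.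
Qed.

Lemma sum_reps_sqr :
  (\sum_(c : {poly_n F}) reps c ^ 2)%:R <= K%:R * (npi F n)%:R + C * (K%:R ^+ 2 * W).
Proof.
have -> : (\sum_(c : {poly_n F}) reps c ^ 2 = \sum_(0 <= k < K) \sum_(0 <= l < K) pair_count k l)%N.
  rewrite !big_mkord; under [RHS]eq_bigr do rewrite big_mkord.
  rewrite (eq_bigr (fun c : {poly_n F} => \sum_(k < K) \sum_(l < K)
     (mirr (mon c - g ^+ k) && mirr (mon c - g ^+ l)))%N); last first.
    move=> c _; rewrite -mulnn /reps big_distrl /=; apply: eq_bigr => k _.
    by rewrite big_distrr /=; apply: eq_bigr => l _; rewrite mulnb.
  rewrite exchange_big /=; apply: eq_bigr => k _.
  rewrite exchange_big /=; apply: eq_bigr => l _.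
  rewrite /pair_count -sum1dep_card [RHS]big_mkcond /=.
  by apply: eq_bigr => c _; case: (_ && _).
exact: sum_pair_count.
Qed.

(* Cauchy-Schwarz on the support of reps. *)
Lemma sqr_sum_reps :
  (K * npi F n)%:R ^+ 2 <= (Rcount n g)%:R * (\sum_(c : {poly_n F}) reps c ^ 2)%:R :> R.
Proof.
rewrite -sum_reps RcountE; set A := [set c | _]; set S := (\sum_c reps c)%N.
have SA : S%:R = \sum_(c in A) (reps c)%:R :> R.
  rewrite /S natr_sum [RHS]big_mkcond /=; apply: eq_bigr => c _; rewrite inE.
  by case: posnP => [->|].
have VA : (\sum_(c : {poly_n F}) reps c ^ 2)%:R = \sum_(c in A) (reps c)%:R ^+ 2 :> R.
  rewrite natr_sum [RHS]big_mkcond /=; apply: eq_bigr => c _; rewrite inE natrX.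
  by case: posnP => [->|]; rewrite ?expr0n.
rewrite VA; set V := \sum_(c in A) _; set a : R := #|A|%:R.
have [A0|A0] := posnP #|A|.
  rewrite SA big_pred0 ?expr0n /= ?mulr_ge0 ?sumr_ge0 // => [c _|c]; first exact: sqr_ge0.
  by rewrite (cards0_eq A0) inE.
have pos : 0 <= \sum_(c in A) (a * (reps c)%:R - S%:R) ^+ 2 by apply: sumr_ge0 => c _; apply: sqr_ge0.
have e : \sum_(c in A) (a * (reps c)%:R - S%:R) ^+ 2 = a * (a * V - S%:R ^+ 2).
  transitivity (a ^+ 2 * V - 2 * a * S%:R * \sum_(c in A) (reps c)%:R + \sum_(c in A) S%:R ^+ 2).
    rewrite /V !mulr_sumr -sumrB -big_split /=; apply: eq_bigr => c _; ring.
  by rewrite -SA sumr_const -[_ *+ _]mulr_natl -/a; ring.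
by move: pos; rewrite e pmulr_rge0 ?ltr0n // subr_ge0.
Qed.

End Representations.

Theorem theorem1 (R : realType) (F : finFieldType) (g : {poly F}) (n : nat) :
  (1 <= (size g).-1)%N -> (1 <= n)%N ->
  let q : R := #|F|%:R in
  let d : R := ((size g).-1)%:R in
  let r : R := rdens R n g in
  (1 + d / n%:R) / d >= r /\
  r > (1 - 2 * q `^ (- (n%:R / 2))) ^+ 2 * (1 + d / n%:R)^-1 /
      (d + 8 * (q / (q - 1)) *
         (1 + expR (euler_gamma R) *
              Num.min (5 * Num.sqrt (d / q)) (ln (6 * d) / ln q))).
Proof.
move=> g_deg n_gt0 q d r.
have q1 : 1 < q by exact: qR_gt1.
have d1 : 1 <= d by rewrite ler1n.
have nR : 1 <= n%:R :> R by rewrite ler1n.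
have qn : 0 < q ^+ n by rewrite exprn_gt0 // (lt_trans ltr01).
have [K1 K2] := @num_exp_bounds F g n g_deg n_gt0.
set K := num_exp g n in K1 K2.
have K1R : n%:R <= K%:R * d by rewrite -natrM ler_nat.
have K2R : K%:R * d <= n%:R + d by rewrite -natrM -natrD ler_nat.
have K0 : 0 < K%:R :> R by rewrite ltr0n.
pose P : R := n%:R * (npi F n)%:R / q ^+ n.
have P1 : P <= 1.
  by rewrite ler_pdivrMr // mul1r -natrM -natrX ler_nat npi_le.
have piE : (npi F n)%:R = P * q ^+ n / n%:R :> R.
  by rewrite /P; field; rewrite !lt0r_neq0 //; lra.
split.
  rewrite /r /rdens ler_pdivrMr //.
  apply: (@le_trans _ _ (K%:R * (npi F n)%:R)); first by rewrite -natrM ler_nat Rcount_le.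
  rewrite piE.
  have -> : (1 + d / n%:R) / d * q ^+ n = (n%:R + d) / d * (q ^+ n / n%:R).
    by field; rewrite !lt0r_neq0 //; lra.
  have -> : K%:R * (P * q ^+ n / n%:R) = (K%:R * P) * (q ^+ n / n%:R) by ring.
  rewrite ler_wpM2r ?divr_ge0 ?(ltW qn) //.
  apply: (@le_trans _ _ K%:R); first by rewrite ler_piMr // ltW.
  by rewrite ler_pdivlMr //; lra.
have [Pabs P0] := npi_lower R F n_gt0; rewrite -/q -/P in Pabs P0.
set B := 1 - 2 * _ in Pabs *.
rewrite -/(mean_bound R g); set W := q / (q - 1) * mean_bound R g.
have W0 : 0 <= W.
  by rewrite mulr_ge0 ?divr_ge0 ?mean_bound_ge0 // ?subr_ge0 ?ltW // (lt_trans ltr01).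
have -> : 8 * (q / (q - 1)) * mean_bound R g = 8 * W by rewrite /W; ring.
have Den : 0 < d + 8 * W by lra.
(* Both moments have the common factor (K q^n / n)^2. After cancelling it, the diagonal contributes
   n P / K, at most d because P <= 1 and n <= K d. *)
have key : P ^+ 2 <= r * (d + 8 * W).
  have cs := sqr_sum_reps R g_deg n_gt0; have v := sum_reps_sqr R g_deg n_gt0.
  rewrite -/q -/W -/K in cs v.
  have : (K * npi F n)%:R ^+ 2 <= (Rcount n g)%:R * (K%:R * (npi F n)%:R + 8 * q ^+ n / n%:R ^+ 2 * (K%:R ^+ 2 * W)) :> R.
    by apply: (le_trans cs); rewrite ler_wpM2l.
  have -> : (Rcount n g)%:R = r * q ^+ n :> R by rewrite /r /rdens divfK // lt0r_neq0.
  rewrite natrM piE.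
  have -> : (K%:R * (P * q ^+ n / n%:R)) ^+ 2 = P ^+ 2 * (K%:R * q ^+ n / n%:R) ^+ 2 by ring.
  have -> : r * q ^+ n * (K%:R * (P * q ^+ n / n%:R) + 8 * q ^+ n / n%:R ^+ 2 * (K%:R ^+ 2 * W)) =
     r * (n%:R / K%:R * P + 8 * W) * (K%:R * q ^+ n / n%:R) ^+ 2.
    by field; rewrite !lt0r_neq0 //; lra.
  rewrite ler_pM2r; last by rewrite exprn_gt0 // divr_gt0 ?mulr_gt0 //; lra.
  move/le_trans; apply; rewrite ler_wpM2l ?divr_ge0 ?(ltW qn) // lerD2r.
  apply: (@le_trans _ _ (n%:R / K%:R)).
    by rewrite ler_piMr // divr_ge0 // ltW.
  by rewrite ler_pdivrMr // mulrC.
have BP : B ^+ 2 <= P ^+ 2.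
  by rewrite -(real_normK (num_real B)) lerXn2r ?nnegrE // ltW.
rewrite ltr_pdivrMr // ; apply: lt_le_trans key.
(* Strictness comes from (1 + d/n)^-1 < 1 multiplied by P^2 > 0; B itself may vanish, namely when
   q^n = 4. *)
apply: (@le_lt_trans _ _ (P ^+ 2 * (1 + d / n%:R)^-1)).
  by rewrite ler_wpM2r // invr_ge0 addr_ge0 // divr_ge0 //; lra.
have P2 : 0 < P ^+ 2 by rewrite exprn_gt0.
have dn : 0 < d / n%:R by rewrite divr_gt0 //; lra.
by rewrite -[ltRHS]mulr1 ltr_pM2l // invf_lt1; lra.
Qed.
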